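(* Let $\mathbf{k}$ be an algebraically closed field of characteristic zero, $S=\mathbf{k}[x_0,\dots,x_n]$ and $\Gamma=\mathbf{k}[y_0,\dots,y_n]$, where $S$ acts on $\Gamma$ by derivation $\circ$. Let $2\le d_0\le\dots\le d_n$ be integers, let $s=\sum_{i=0}^n d_i-(n+1)$, and let $Z_1,Z_2\subset \mathbb{E}=\mathbb{V}\times\mathbb{P}^{N(s)}_{\mathbf{k}}$ be the subsets defined in the context. Let $H\in\Gamma$ be a nonzero homogeneous form of degree $s$. Then $\operatorname{Ann}\langle H\rangle$ is a complete intersection of type $(d_0,\dots,d_n)$ if and only if $$(Z_1)_H\nsubseteq (Z_2)_H.$$ Moreover, the set of $[H]\in\mathbb{P}^{N(s)}_{\mathbf{k}}$ such that $(Z_1)_H\nsubseteq (Z_2)_H$ is a locally constructible subset of $\mathbb{P}^{N(s)}_{\mathbf{k}}$.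
   Context: The polynomial rings $S$ and $\Gamma$ are graded in the standard way. $\Gamma$ is an $S$-module by derivation: for $f\in S$ and $g\in\Gamma$, $f\circ g=f(\partial_{y_0},\dots,\partial_{y_n})(g)$. For $H\in\Gamma$, $\langle H\rangle$ is the sub-$S$-module of $\Gamma$ generated by $H$, and $\operatorname{Ann}\langle H\rangle=\{g\in S: g\circ H=0\}$. A homogeneous ideal $I\subset S$ is a complete intersection of type $(d_0,\dots,d_n)$, with $2\le d_0\le\dots\le d_n$, if there exists a homogeneous regular sequence $f_0,\dots,f_n$ minimally generating $I$ with $\deg(f_i)=d_i$ for $i=0,\dots,n$. For an integer $d\ge1$ let $N(d)=\binom{n+d}{n}-1$, so that $\mathbb{P}^{N(d)}_{\mathbf{k}}$ parametrizes nonzero forms of degree $d$ in $n+1$ variables up to nonzero scalars. Put $\mathbb{V}=\prod_{i=0}^n\mathbb{P}^{N(d_i)}_{\mathbf{k}}$, which parametrizes $(n+1)$-tuples $\underline{f}=(f_0,\dots,f_n)$ of forms in $S$ with $\deg f_i=d_i$, and $\mathbb{E}=\mathbb{V}\times\mathbb{P}^{N(s)}_{\mathbf{k}}$, which parametrizes pairs $(\underline{f},[H])$ with $\underline{f}=(f_0,\dots,f_n)$ an $(n+1)$-tuple of forms in $S$ with $\deg f_i=d_i$ for $i=0,\dots,n$, and $H\in\Gamma$ a form of degree $s$. Let $\pi:\mathbb{E}\to\mathbb{P}^{N(s)}_{\mathbf{k}}$ be the projection to the second component. $\operatorname{Res}(\underline{f})$ is the (projective) resultant of $f_0,\dots,f_n$,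 the irreducible polynomial in the coefficients of the forms defining the hypersurface of tuples with a common zero in $\mathbb{P}^n_{\mathbf{k}}$; so $\operatorname{Res}(\underline{f})\neq0$ if and only if $f_0,\dots,f_n$ have no common zero in $\mathbb{P}^n_{\mathbf{k}}$. $\operatorname{Jac}(\underline{f})=(\partial f_i/\partial x_j)_{0\le i,j\le n}$ is the Jacobian matrix. Let $U\subset\mathbb{E}$ be the open subset of pairs $(\underline{f},[H])$ with $\operatorname{Res}(\underline{f})\neq0$. Let $Z_1$ be the locally closed subset of $\mathbb{E}$ of pairs $(\underline{f},[H])\in U$ with $f_i\circ H=0$ for all $i=0,\dots,n$, and let $Z_2$ be the closed subset of $\mathbb{E}$ of pairs $(\underline{f},[H])$ with $\det(\operatorname{Jac}(\underline{f}))\circ H=0$. For $[H]\in\mathbb{P}^{N(s)}_{\mathbf{k}}$ and $i=1,2$, $(Z_i)_H=Z_i\cap\pi^{-1}([H])$ denotes the fiber of $Z_i$ over $[H]$. *)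

(* Defs.v *)
From HB Require Import structures.
From mathcomp Require Import all_boot all_order all_algebra.
From mathcomp Require Export mpoly.

Set Implicit Arguments.
Unset Strict Implicit.
Unset Printing Implicit Defensive.

Import GRing.Theory.
Local Open Scope ring_scope.

(* Both S = k[x_0, ..., x_n] and Gamma = k[y_0, ..., y_n] are rendered as
   {mpoly k[n.+1]}; the S-module structure of Gamma is [apolar]. *)

Section Algebra.
Variables (k : closedFieldType) (n : nat).
Local Notation S := {mpoly k[n.+1]}.

Definition apolar (f g : S) : S :=
  \sum_(m <- msupp f) f@_m *: mderivm m g.

Definition annihilator (H : S) : S -> Prop := fun g => apolar g H = 0.

Definition jacobian (f : 'I_n.+1 -> S) : 'M[S]_n.+1 :=
  \matrix_(i, j) mderiv j (f i).

(* The ideal generated by the f_j such that P j. *)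
Definition ideal_gen (r : nat) (P : pred 'I_r) (f : 'I_r -> S) : S -> Prop :=
  fun p => exists a : 'I_r -> S, p = \sum_(j | P j) a j * f j.

Definition regular_sequence (r : nat) (f : 'I_r -> S) : Prop :=
  (forall (i : 'I_r) (p : S),
     ideal_gen (fun j => (j < i)%N) f (p * f i) ->
     ideal_gen (fun j => (j < i)%N) f p)
  /\ ~ ideal_gen predT f 1.

Definition minimally_generates (r : nat) (f : 'I_r -> S) (I : S -> Prop) :
    Prop :=
  (forall p, I p <-> ideal_gen predT f p)
  /\ (forall i, ~ (forall p, I p <-> ideal_gen (predC1 i) f p)).

(* I is a homogeneous ideal, being generated by the forms f_i. *)
Definition complete_intersection (d : 'I_n.+1 -> nat) (I : S -> Prop) : Prop :=
  exists f : 'I_n.+1 -> S,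
    [/\ forall i, f i != 0 /\ f i \is (d i).-homog,
        regular_sequence f
      & minimally_generates f I].

End Algebra.

Definition hform (k : closedFieldType) (n d : nat) : vectType k :=
  dhomog n.+1 k d.

Section Projective.
Variables (k : closedFieldType) (V : vectType k).

(* The projective space of lines of V. *)
Definition projective : Type := {L : {vspace V} | \dim L == 1%N}.

Definition represents (x : projective) (v : V) : Prop :=
  v != 0 /\ val x = <[v]>%VS.

Lemma dim_line_eq1 (v : V) : v != 0 -> \dim <[v]>%VS == 1%N.
Proof. by move=> v0; rewrite dim_vline v0. Qed.

(* The point [v] of a nonzero vector v. *)
Definition point (v : V) (v0 : v != 0) : projective :=
  exist _ <[v]>%VS (dim_line_eq1 v0).

End Projective.

Section Zariski.
Variables (k : closedFieldType) (n d : nat).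

Definition monomial : finType := {m : 'X_{1..n.+1 < d.+1} | mdeg m == d}.

(* Homogeneous coordinates on the projective space of forms of degree d:
   the coefficients, indexed by the monomials of degree d. *)
Definition coordinates (g : hform k n d) : 'I_#|monomial| -> k :=
  fun t => (mpoly_of_dhomog g)@_(val (val (enum_val t))).

Local Notation PN := (projective (hform k n d)).

Definition zariski_closed (C : PN -> Prop) : Prop :=
  exists F : {mpoly k[#|monomial|]} -> Prop,
    (forall p, F p -> exists e : nat, p \is e.-homog)
    /\ (forall x, C x <->
          (forall p, F p -> forall g, represents x g ->
             p.@[coordinates g] = 0)).

Definition zariski_open (O : PN -> Prop) : Prop :=
  zariski_closed (fun x => ~ O x).

(* A `&` U is a finite union of locally closed subsets of the open set U; as
   projective space is noetherian, every open subset is retrocompact. *)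
Definition constructible_in (U A : PN -> Prop) : Prop :=
  exists (r : nat) (O C : 'I_r -> PN -> Prop),
    (forall l, zariski_open (O l) /\ zariski_closed (C l))
    /\ (forall x, U x -> (A x <-> exists l, O l x /\ C l x)).

Definition locally_constructible (A : PN -> Prop) : Prop :=
  forall x, exists U : PN -> Prop,
    [/\ zariski_open U, U x & constructible_in U A].

End Zariski.

Section Resultant.
Variables (k : closedFieldType) (n : nat) (d : 'I_n.+1 -> nat).

(* One variable for each coefficient of each of the n + 1 forms. *)
Definition coef_index : finType := {i : 'I_n.+1 & monomial n (d i)}.

Definition coefficients (f : forall i, hform k n (d i)) :
    'I_#|coef_index| -> k :=
  fun t => let u := enum_val t in
    (mpoly_of_dhomog (f (tag u)))@_(val (val (tagged u))).

Definition irreducible_element (R : idomainType) (p : R) : Prop :=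
  [/\ p != 0, p \isn't a GRing.unit
    & forall a b, p = a * b -> a \is a GRing.unit \/ b \is a GRing.unit].

Definition common_zero (f : forall i, hform k n (d i)) : Prop :=
  exists x : 'I_n.+1 -> k,
    (exists i, x i != 0)
    /\ (forall i, (mpoly_of_dhomog (f i)).@[x] = 0).

(* Res is determined by this up to a nonzero constant factor. *)
Definition is_resultant (Res : {mpoly k[#|coef_index|]}) : Prop :=
  irreducible_element Res
  /\ (forall f : forall i, hform k n (d i), (forall i, f i != 0) ->
        (Res.@[coefficients f] = 0 <-> common_zero f)).

End Resultant.

Section Incidence.
Variables (k : closedFieldType) (n : nat) (d : 'I_n.+1 -> nat).

Definition socle_degree : nat := (\sum_(i < n.+1) d i - n.+1)%N.

Definition VV : Type := forall i, projective (hform k n (d i)).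
Definition PP : Type := projective (hform k n socle_degree).
Definition EE : Type := (VV * PP)%type.

Definition Z1 (Res : {mpoly k[#|coef_index d|]}) : EE -> Prop :=
  fun e => exists (f : forall i, hform k n (d i)) (H : hform k n socle_degree),
    [/\ forall i, represents (e.1 i) (f i), represents e.2 H,
        Res.@[coefficients f] != 0
      & forall i, apolar (mpoly_of_dhomog (f i)) (mpoly_of_dhomog H) = 0].

Definition Z2 : EE -> Prop :=
  fun e => exists (f : forall i, hform k n (d i)) (H : hform k n socle_degree),
    [/\ forall i, represents (e.1 i) (f i), represents e.2 H
      & apolar (\det (jacobian (fun i => mpoly_of_dhomog (f i))))
               (mpoly_of_dhomog H) = 0].

Definition fiber (Z : EE -> Prop) (h : PP) : EE -> Prop :=
  fun e => Z e /\ e.2 = h.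

Definition included (A B : EE -> Prop) : Prop := forall e, A e -> B e.

End Incidence.

(* Main.v *)
From HB Require Import structures.
Require Import Defs.
From mathcomp Require Import all_boot all_order all_algebra.
From mathcomp Require Import ssrcomplements zify.
From Stdlib Require Import Classical.

Set Implicit Arguments.
Unset Strict Implicit.
Unset Printing Implicit Defensive.

Import GRing.Theory.
Local Open Scope ring_scope.

(** Write S = k[x_0, ..., x_n], let f_0, ..., f_n be forms of degrees d_i and
    let I be the ideal that they generate.

    A form H that is annihilated by I gives linear functionals on S that vanish
    on I, and the whole proof turns on how much of S / I one such functional
    controls. The tool is the Bezoutian. Writing
    f_i(x) - f_i(y) = sum_j a_ij (x_j - y_j) and B = det a, Cramer's rule says
    that (g(x) - g(y)) B lies in the ideal of the f_i(x) - f_i(y), for every g.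
    Applying a functional phi that kills I to the x-variables yields
    g w = phi(g(x) B) modulo I, with w = phi(B) (lemma [bezout_reproduce]). The
    constant term of w is phi(det a(x, 0)), where a(x, 0) is a transition matrix
    from f to x. If it is nonzero, w is a unit modulo every power of the
    irrelevant ideal, so phi(g S) = 0 forces g to be in the homogeneous ideal I.

    The criterion. If f_i o H = 0 and Jac(f) o H is nonzero, take for phi a
    coefficient of p o H. By Euler's formula the matrix (d_j f_i / d_i) is a
    transition matrix from f to x, and in characteristic 0 the Bezout matrix can
    be chosen to specialise to it at y = 0 ([euler_bezout_matrix]). Hence every
    g that annihilates H is in I ([annihilator_eq_ideal]), and then I contains
    a power of every variable, since Ann H does.

    It remains to see that such f form a regular sequence and generate
    minimally, and conversely that Jac(f) is not in I when Ann H = I. Both rest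
    on an explicit functional. If x_l^N = sum_i M_li f_i, the coefficient of
    (x_0 ... x_n)^(N-1) in det(M) p kills I and takes the value 1 at every
    transition determinant from f to x ([exists_residue]); so these
    determinants, among them Jac(f) up to a nonzero scalar, are not in I. For
    regularity, replace f_i by f_i^(e+1): the Bezoutian acquires the factor
    sum_c f_i(x)^(e-c) f_i(y)^c, and if p f_i is in the ideal of the other f_j,
    only the term f_i(y)^e survives in phi(p(x) B); thus p is in the ideal of
    the other f_j up to a multiple of f_i^e ([colon_power]). Letting e and the
    exponents of the later f_j grow, homogeneity gives regularity
    ([mprimary_regular]). Since I contains powers of the variables, the f_i have
    no common zero, that is, their resultant is nonzero.

    Constructibility. For fixed H the tuples f with f_i o H = 0 form the kernel
    of a matrix C(H) whose entries are linear in H, and the condition on [H]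
    says that some polynomial in f and H does not vanish identically on this
    kernel. Where C(H) has rank r, an r-minor that is nonzero provides a
    polynomial parametrisation of the kernel, and the condition becomes the
    nonvanishing of a family of polynomials in H. So the set is a finite union,
    over r, of an open set intersected with the closed set where the rank is at
    most r ([kernel_nonvanishing_constructible]). *)

(** * Ideals generated by finite families *)
Section Ideals.
Variables (k : closedFieldType) (n r : nat).
Local Notation S := {mpoly k[n.+1]}.
Implicit Types (P Q : pred 'I_r) (f g : 'I_r -> S) (p q : S).

Lemma ideal_gen0 P f : ideal_gen P f 0.
Proof. by exists (fun=> 0); rewrite big1 // => i _; rewrite mul0r. Qed.

Lemma ideal_genD P f p q :
  ideal_gen P f p -> ideal_gen P f q -> ideal_gen P f (p + q).
Proof.
move=> [a ->] [b ->]; exists (fun i => a i + b i); rewrite -big_split /=.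
by apply: eq_bigr => i _; rewrite mulrDl.
Qed.

Lemma ideal_genM P f p q : ideal_gen P f q -> ideal_gen P f (p * q).
Proof.
move=> [a ->]; exists (fun i => p * a i); rewrite big_distrr /=.
by apply: eq_bigr => i _; rewrite mulrA.
Qed.

Lemma ideal_gen_mem P f i : P i -> ideal_gen P f (f i).
Proof.
move=> Pi; exists (fun j => (j == i)%:R); rewrite (bigD1 i) //= eqxx mul1r.
by rewrite big1 ?addr0 // => j /andP[_ /negPf->]; rewrite mul0r.
Qed.

Lemma ideal_gen_sum P f (J : Type) (s : seq J) (R : pred J) (F : J -> S) :
  (forall j, R j -> ideal_gen P f (F j)) ->
  ideal_gen P f (\sum_(j <- s | R j) F j).
Proof.
by move=> h; apply: (big_ind (ideal_gen P f)) => //;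
  [exact: ideal_gen0 | move=> x y; exact: ideal_genD].
Qed.

Lemma ideal_gen_sub P f (Q : S -> Prop) p :
  Q 0 -> (forall x y, Q x -> Q y -> Q (x + y)) ->
  (forall x i, P i -> Q (x * f i)) -> ideal_gen P f p -> Q p.
Proof. by move=> Q0 QD QM [a ->]; apply: big_ind => // i; apply: QM. Qed.

Lemma ideal_gen_trans P Q f g p :
  (forall i, P i -> ideal_gen Q g (f i)) -> ideal_gen P f p -> ideal_gen Q g p.
Proof.
move=> h; apply: ideal_gen_sub => [|x y|x i Pi]; first exact: ideal_gen0.
  exact: ideal_genD.
by apply: ideal_genM; apply: h.
Qed.

Lemma ideal_gen_matrix P f (m : nat) (g : 'I_m -> S) :
  (forall i, ideal_gen P f (g i)) ->
  exists M : 'I_m -> 'I_r -> S, forall i, g i = \sum_(j | P j) M i j * f j.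
Proof. by move=> /fin_all_exists. Qed.

(** In the binomial expansion of [(p + q)^(a + b)] every term is
    a multiple of [p^a] or of [q^b], so the radical of an ideal is additively
    closed. *)
Lemma radical_add P f p q a b :
  ideal_gen P f (p ^+ a) -> ideal_gen P f (q ^+ b) ->
  ideal_gen P f ((p + q) ^+ (a + b)).
Proof.
move=> hp hq; rewrite exprDn; apply: ideal_gen_sum => i _.
rewrite -mulr_natl; apply: ideal_genM.
case: (leqP b i) => hi.
  by rewrite -(subnK hi) exprD mulrA; apply: ideal_genM.
rewrite mulrC; apply: ideal_genM.
(* [i < b], so the exponent [a + b - i] of [p] is at least [a]. *)
have -> : (a + b - i = (b - i) + a)%N by lia.
by rewrite exprD; apply: ideal_genM.
Qed.

Lemma radical_gen P Q f g (T : nat) p :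
  (forall i, P i -> ideal_gen Q g (f i ^+ T)) ->
  ideal_gen P f p -> exists N, ideal_gen Q g (p ^+ N).
Proof.
move=> h.
apply: (ideal_gen_sub (Q := fun x => exists N, ideal_gen Q g (x ^+ N))).
- by exists 1%N; apply: ideal_gen0.
- by move=> x y [a ha] [b hb]; exists (a + b)%N; apply: radical_add.
- by move=> x i Pi; exists T; rewrite exprMn; apply: ideal_genM; apply: h.
Qed.

End Ideals.

(** The form of Cramer's rule that is used for every transition matrix below:
    multiplying by the determinant moves each [v j] into the ideal of the
    [w i]. *)
Lemma cramer (R : comRingType) (m : nat) (A : 'M[R]_m) (v w : 'I_m -> R) :
  (forall i, w i = \sum_j A i j * v j) ->
  forall j, \det A * v j = \sum_i (\adj A) j i * w i.
Proof.
move=> h j; have e := mul_adj_mx A.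
have {e} : ((\adj A *m A) *m \col_l v l) j 0 = ((\det A)%:M *m \col_l v l) j 0.
  by rewrite e.
rewrite mul_scalar_mx -mulmxA !mxE => <-; apply: eq_bigr => i _.
by rewrite h !mxE; congr (_ * _); apply: eq_bigr => l _; rewrite mxE.
Qed.

(** * A residue functional *)
Section Residue.
Variables (k : closedFieldType) (n : nat).
Local Notation S := {mpoly k[n.+1]}.

Definition corner (N : nat) : 'X_{1..n.+1} := [multinom N | _ < n.+1].

Lemma mcoeff_mulXn_small (q : S) i N (m : 'X_{1..n.+1}) :
  (m i < N)%N -> (q * 'X_i ^+ N)@_m = 0.
Proof.
move=> lt_mN; rewrite mpolyXn mcoeffM big1 // => -[/= k1 k2] /eqP e.
rewrite mcoeffX; case: eqP => [ek|_]; last by rewrite mulr0.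
move/(congr1 (fun x : 'X_{1..n.+1} => x i)): e.
rewrite -ek mnmDE mulmnE mnm1E eqxx mul1n => e.
by move: lt_mN; rewrite e ltnNge leq_addl.
Qed.

(** By Cramer's rule [\det B * 'X_i] is a combination of the ['X_l ^+ N.+1]
    with [l != i], because the [i]-th entry of [B] times the vector of variables
    is zero. None of these multiples contains the monomial [corner N] times
    ['X_i], whose exponent at [l] is only [N]. *)
Lemma det_syzygy_row N (B : 'M[S]_n.+1) i :
  (forall l, l != i -> \sum_j B l j * 'X_j = 'X_l ^+ N.+1) ->
  \sum_j B i j * 'X_j = 0 -> (\det B)@_(corner N) = 0.
Proof.
move=> hB hi; pose w l : S := if l == i then 0 else 'X_l ^+ N.+1.
have hw l : w l = \sum_j B l j * 'X_j.
  by rewrite /w; case: eqVneq => [->|/hB].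
have := cramer hw i => /(congr1 (mcoeff (U_(i) + corner N)%MM)).
rewrite mcoeffMX => ->; rewrite raddf_sum big1 // => l _ /=.
rewrite /w; case: eqVneq => [_|nli]; first by rewrite mulr0 mcoeff0.
apply: mcoeff_mulXn_small.
by rewrite mnmDE mnm1E eq_sym (negPf nli) mnmE.
Qed.

(** For the diagonal matrix of the ['X_l ^+ N] the determinant is the monomial
    [corner N] itself. Any other transition matrix is reached by exchanging one
    row at a time, and the difference of two admissible rows is a syzygy of the
    variables, to which [det_syzygy_row] applies. *)
Lemma transition_det N (B : 'M[S]_n.+1) :
  (forall l, \sum_j B l j * 'X_j = 'X_l ^+ N.+1) -> (\det B)@_(corner N) = 1.
Proof.
pose D : 'M[S]_n.+1 := diag_mx (\row_j 'X_j ^+ N).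
have hD l : \sum_j D l j * 'X_j = 'X_l ^+ N.+1.
  rewrite (bigD1 l) //= !mxE eqxx mulr1n -exprSr big1 ?addr0 // => j njl.
  by rewrite !mxE eq_sym (negPf njl) mulr0n mul0r.
have detD : \det D = 'X_[corner N].
  rewrite det_diag mpolyXE_id; apply: eq_bigr => i _.
  by rewrite mxE mnmE.
(* Induction on the number [m] of leading rows that may differ from [D]. *)
suff H m : forall B : 'M[S]_n.+1,
    (forall l, \sum_j B l j * 'X_j = 'X_l ^+ N.+1) ->
    (forall l : 'I_n.+1, (m <= l)%N -> row l B = row l D) ->
    (\det B)@_(corner N) = 1.
  by move=> hB; apply: (H n.+1) => // l; rewrite leqNgt ltn_ord.
elim: m => [|m IH] {}B hB hrow.
  have -> : B = D by apply/row_matrixP => i; apply: hrow.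
  by rewrite detD mcoeffX eqxx.
case: (ltnP m n.+1) => [lt_mn|le_nm]; last first.
  apply: IH => // l le_ml; move: (leq_trans le_nm le_ml).
  by rewrite leqNgt ltn_ord.
pose i := Ordinal lt_mn.
pose B1 : 'M[S]_n.+1 := \matrix_(l, j) (if l == i then D l j else B l j).
pose B2 : 'M[S]_n.+1 :=
  \matrix_(l, j) (if l == i then B l j - D l j else B l j).
have -> : \det B = \det B1 + \det B2.
  rewrite -[\det B1]mul1r -[\det B2]mul1r.
  apply: (determinant_multilinear (i0 := i)).
  - by apply/rowP => j; rewrite !mxE eqxx !mul1r addrC subrK.
  - by apply/matrixP => l j; rewrite !mxE eq_sym (negPf (neq_lift _ _)).
  - by apply/matrixP => l j; rewrite !mxE eq_sym (negPf (neq_lift _ _)).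
rewrite mcoeffD IH => [||l le_ml].
- rewrite (@det_syzygy_row N B2 i) ?addr0 // => [l /negPf nli|].
    by rewrite -hB; apply: eq_bigr => j _; rewrite mxE nli.
  rewrite (eq_bigr (fun j => B i j * 'X_j - D i j * 'X_j)).
    by rewrite sumrB hB hD subrr.
  by move=> j _; rewrite mxE eqxx mulrBl.
- move=> l; case: (eqVneq l i) => [->|/negPf nli].
    by rewrite -hD; apply: eq_bigr => j _; rewrite mxE eqxx.
  by rewrite -hB; apply: eq_bigr => j _; rewrite mxE nli.
- apply/rowP => j; rewrite !mxE; case: eqVneq => // nli.
  have /hrow/rowP/(_ j) : (m < l)%N.
    rewrite ltn_neqAle le_ml andbT eq_sym; apply: contra_neq nli => e.
    exact: val_inj.
  by rewrite !mxE.
Qed.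

Definition residue (u : S) (m : 'X_{1..n.+1}) (p : S) : k := (u * p)@_m.

Lemma residue_is_scalar u m : scalar (residue u m).
Proof. by move=> c p q; rewrite /residue mulrDr -scalerAr mcoeffD mcoeffZ. Qed.

HB.instance Definition _ u m :=
  GRing.isLinear.Build k S k *%R (residue u m) (residue_is_scalar u m).

(** The functional is the coefficient of [corner N] in [\det B * p], where [B]
    expresses the powers of the variables through [f]. It kills the ideal of
    [f] because [\det B] multiplies it into the ideal of these powers; and
    [B *m A] is a transition matrix from the variables to their powers. *)
Lemma exists_residue N (f : 'I_n.+1 -> S) (A : 'M[S]_n.+1) :
  (forall i, f i = \sum_j A i j * 'X_j) ->
  (forall l, ideal_gen predT f ('X_l ^+ N.+1)) ->
  exists phi : {scalar S},
    (forall p i, phi (p * f i) = 0) /\ phi (\det A) = 1.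
Proof.
move=> hA /ideal_gen_matrix[M hM]; pose B : 'M[S]_n.+1 := \matrix_(l, i) M l i.
have hB l : 'X_l ^+ N.+1 = \sum_i B l i * f i.
  by rewrite hM; apply: eq_bigr => i _; rewrite mxE.
exists (residue (\det B) (corner N)); split=> /= [p i|].
  rewrite /residue mulrCA (cramer hB) mulr_sumr raddf_sum big1 // => l _ /=.
  by rewrite mulrA mcoeff_mulXn_small // mnmE.
rewrite /residue -det_mulmx; apply: transition_det => l.
rewrite hB [RHS](eq_bigr (fun i => \sum_j B l i * (A i j * 'X_j))).
  2: by move=> i _; rewrite hA big_distrr.
rewrite [RHS]exchange_big /=; apply: eq_bigr => j _; rewrite mxE big_distrl /=.
by apply: eq_bigr => i _; rewrite mulrA.
Qed.

End Residue.

(** * The Bezoutian *)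
Lemma subr_mul_telescope (R : comRingType) (a b c d : R) :
  a * b - c * d = a * (b - d) + d * (a - c).
Proof. by rewrite !mulrBr addrA mulrC [d * c]mulrC [a * d]mulrC subrK. Qed.

Section Bezoutian.
Variables (k : closedFieldType) (n : nat).
Local Notation S := {mpoly k[n.+1]}.
Local Notation T := {mpoly {mpoly k[n.+1]}[n.+1]}.
Implicit Types (p q g : S) (P : T) (f : 'I_n.+1 -> S) (phi : {scalar S}).

(** Polynomials in two sets of variables [x], [y] are encoded as polynomials in
    [y] with coefficients in [k[x]]: [p(x)] is the constant [p%:MP], [p(y)] is
    [outer p], setting [y] to zero is [mcoeff 0], and applying a functional to
    the [x]-part is [map_mpoly phi]. *)
Definition outer p : T := map_mpoly (@mpolyC n.+1 k) p.

Definition bdiff p : T := p%:MP - outer p.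

Lemma bdiffM p q : bdiff (p * q) = p%:MP * bdiff q + outer q * bdiff p.
Proof. by rewrite /bdiff /outer !rmorphM /= subr_mul_telescope. Qed.

Lemma outerE p m : (outer p)@_m = (p@_m)%:MP.
Proof. exact: mcoeff_map_mpoly. Qed.

Lemma bdiff_coef0 p : p@_0%MM = 0 -> (bdiff p)@_0%MM = p.
Proof.
by move=> p0; rewrite mcoeffB outerE p0 mpolyC0 subr0 mcoeffC eqxx mulr1.
Qed.

Lemma bdiff_vars p :
  exists a : 'I_n.+1 -> T, bdiff p = \sum_j a j * bdiff 'X_j.
Proof.
pose Q p := exists a : 'I_n.+1 -> T, bdiff p = \sum_j a j * bdiff 'X_j.
have QD x y : Q x -> Q y -> Q (x + y).
  move=> [a ha] [b hb]; exists (fun j => a j + b j).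
  transitivity (bdiff x + bdiff y).
    by rewrite /bdiff /outer !rmorphD /= opprD addrACA.
  by rewrite ha hb -big_split; apply: eq_bigr => j _; rewrite mulrDl.
have QM x y : Q x -> Q y -> Q (x * y).
  move=> [a ha] [b hb]; exists (fun j => x%:MP * b j + outer y * a j).
  rewrite bdiffM ha hb !mulr_sumr -big_split; apply: eq_bigr => j _ /=.
  by rewrite mulrDl !mulrA.
have QC c : Q c%:MP.
  exists (fun=> 0); rewrite big1 => [|j _]; last by rewrite mul0r.
  by rewrite /bdiff /outer map_mpolyC subrr.
have QX i : Q 'X_i.
  exists (fun j => (j == i)%:R).
  rewrite (bigD1 i) //= eqxx mul1r big1 ?addr0 //.
  by move=> j /negPf->; rewrite mul0r.
have Q0 : Q 0 by rewrite -(mpolyC0 n.+1 k); apply: QC.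
have Q1 : Q 1 by rewrite -(mpolyC1 n.+1 k); apply: QC.
elim/mpolyind: p => [|c m p _ _ Qp]; first exact: Q0.
apply: (QD _ _ _ Qp); rewrite -mul_mpolyC; apply: (QM); first exact: QC.
rewrite mpolyXE_id.
apply: big_ind => [||i _]; [exact: Q1 | by move=> x y; apply: QM |].
elim: (m i) => [|e IH]; first by rewrite expr0; exact: Q1.
by rewrite exprS; apply: QM; [exact: QX | exact: IH].
Qed.

Definition bezout_matrix f (A : 'M[T]_n.+1) :=
  forall i, bdiff (f i) = \sum_j A i j * bdiff 'X_j.

Lemma bezout_matrix_exists f : exists A, bezout_matrix f A.
Proof.
have /fin_all_exists[a ha] := fun i => bdiff_vars (f i).
exists (\matrix_(i, j) a i j) => i.
by rewrite ha; apply: eq_bigr => j _; rewrite mxE.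
Qed.

Lemma bezout_matrix_coef0 f A i :
  bezout_matrix f A -> (f i)@_0%MM = 0 ->
  f i = \sum_j (map_mx (mcoeff 0%MM) A) i j * 'X_j.
Proof.
move=> /(_ i) /(congr1 (mcoeff 0%MM)) hA f0; rewrite -{1}(bdiff_coef0 f0) hA.
rewrite raddf_sum; apply: eq_bigr => j _ /=; rewrite rmorphM /= mxE.
by rewrite bdiff_coef0 // mcoeffX mnm1_eq0.
Qed.

(** The difference [bdiff g] is a combination of the [bdiff 'X_j], and Cramer's
    rule for the matrix [A] turns [bdiff 'X_j * \det A] into a combination of
    the [bdiff (f i)]. *)
Lemma bdiff_bezoutian f A g : bezout_matrix f A ->
  exists e : 'I_n.+1 -> T, bdiff g * \det A = \sum_i e i * bdiff (f i).
Proof.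
move=> hA; have [c ->] := bdiff_vars g.
exists (fun i => \sum_j c j * (\adj A) j i).
rewrite mulr_suml.
rewrite (eq_bigr (fun j => \sum_i c j * ((\adj A) j i * bdiff (f i)))).
  rewrite exchange_big; apply: eq_bigr => i _ /=; rewrite mulr_suml.
  by apply: eq_bigr => j _; rewrite mulrA.
move=> j _; rewrite -mulr_sumr -(cramer hA) -mulrA.
by congr (_ * _); rewrite mulrC.
Qed.

(** [phi] acts on the inner variables only, so the induced map is linear over
    polynomials in the outer ones. *)
Lemma map_outer phi q P : map_mpoly phi (outer q * P) = q * map_mpoly phi P.
Proof.
apply/mpolyP => m; rewrite mcoeff_map_mpoly !mcoeffM raddf_sum.
apply: eq_bigr => i _ /=; rewrite outerE mcoeff_map_mpoly mul_mpolyC linearZ /=.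
by [].
Qed.

Lemma map_kill phi P g :
  (forall p, phi (p * g) = 0) -> map_mpoly phi (P * g%:MP) = 0.
Proof.
move=> h; apply/mpolyP => m.
by rewrite mcoeff_map_mpoly /= mulrC mcoeffCM [g * _]mulrC h mcoeff0.
Qed.

(** Applying [phi] to the inner variables in [bdiff_bezoutian] kills the inner
    copies of the [f i] and leaves the outer copies as elements of the
    ideal. *)
Lemma bezout_reproduce f A phi g : bezout_matrix f A ->
  (forall p i, phi (p * f i) = 0) ->
  ideal_gen predT f
    (g * map_mpoly phi (\det A) - map_mpoly phi (g%:MP * \det A)).
Proof.
move=> /(bdiff_bezoutian g)[e he] hphi.
exists (fun i => map_mpoly phi (e i)).
have -> : g%:MP * \det A = outer g * \det A + \sum_i e i * bdiff (f i).
  by rewrite -he /bdiff -mulrDl addrC subrK.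
rewrite raddfD /= map_outer opprD addrA subrr add0r.
rewrite (raddf_sum (map_mpoly phi)) -sumrN /=.
apply: eq_bigr => i _; rewrite /bdiff mulrBr raddfB /= map_kill // sub0r opprK.
by rewrite mulrC map_outer mulrC.
Qed.

End Bezoutian.

(** * The order at the origin and homogeneous ideals *)
Section MAdic.
Variables (k : closedFieldType) (n : nat).
Local Notation S := {mpoly k[n.+1]}.
Implicit Types (p q w : S).

Definition order_ge (T : nat) p : Prop := forall m, (mdeg m < T)%N -> p@_m = 0.

Lemma order_ge0 T : order_ge T 0.
Proof. by move=> m _; rewrite mcoeff0. Qed.

Lemma order_geD T p q : order_ge T p -> order_ge T q -> order_ge T (p + q).
Proof. by move=> hp hq m hm; rewrite mcoeffD hp // hq // addr0. Qed.

Lemma order_geM a b p q :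
  order_ge a p -> order_ge b q -> order_ge (a + b) (p * q).
Proof.
move=> hp hq m hm; rewrite mcoeffM big1 // => -[/= k1 k2] /eqP e.
have {hm} : (mdeg k1 + mdeg k2 < a + b)%N by rewrite -mdegD -e.
case: (ltnP (mdeg k1) a) => [/hp->|h1 h2]; first by rewrite mul0r.
by rewrite hq ?mulr0 //; lia.
Qed.

Lemma order_geMl T p q : order_ge T q -> order_ge T (p * q).
Proof. by move=> hq; rewrite -[T]add0n; apply: order_geM. Qed.

Lemma order_ge1 p : p@_0%MM = 0 -> order_ge 1 p.
Proof. by move=> p0 m; rewrite ltnS leqn0 mdeg_eq0 => /eqP->. Qed.

Lemma order_geX T p : p@_0%MM = 0 -> order_ge T (p ^+ T).
Proof.
move=> p0; elim: T => [|T IH] //.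
by rewrite exprS -add1n; apply: order_geM IH; apply: order_ge1.
Qed.

Lemma dhomog_coef0 d p : (0 < d)%N -> p \is d.-homog -> p@_0%MM = 0.
Proof.
move=> d_gt0 pd; apply: dhomog_nemf_coeff pd _.
by rewrite [X in X != _]mdeg0 eq_sym -lt0n.
Qed.

(** Membership in the sum of an ideal and the [T]-th power of the irrelevant
    ideal. *)
Definition near_ideal (r : nat) (P : pred 'I_r) (f : 'I_r -> S) T p :=
  exists2 q, order_ge T q & ideal_gen P f (p - q).

Section Near.
Variables (r : nat) (P : pred 'I_r) (f : 'I_r -> S).

Lemma near_ideal_mem T p : ideal_gen P f p -> near_ideal P f T p.
Proof. by exists 0; [apply: order_ge0 | rewrite subr0]. Qed.

Lemma near_ideal_order T p : order_ge T p -> near_ideal P f T p.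
Proof. by exists p => //; rewrite subrr; apply: ideal_gen0. Qed.

Lemma near_idealD T p q :
  near_ideal P f T p -> near_ideal P f T q -> near_ideal P f T (p + q).
Proof.
move=> [x hx ix] [y hy iy]; exists (x + y); first exact: order_geD.
by rewrite opprD addrACA; apply: ideal_genD.
Qed.

Lemma near_idealM T p q : near_ideal P f T q -> near_ideal P f T (p * q).
Proof.
move=> [x hx ix]; exists (p * x); first exact: order_geMl.
by rewrite -mulrBr; apply: ideal_genM.
Qed.

(** An element with constant term [1] is inverted, up to order [T], by the
    truncated geometric series of [1 - w]. *)
Lemma near_ideal_unit T p w :
  w@_0%MM = 1 -> near_ideal P f T (p * w) -> near_ideal P f T p.
Proof.
move=> w1 h; pose v := 1 - w.
have v0 : v@_0%MM = 0 by rewrite mcoeffB mcoeff1 eqxx w1 subrr.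
have sumw : (\sum_(i < T) v ^+ i) * w = 1 - v ^+ T.
  have -> : w = - (v - 1) by rewrite /v addrAC subrr sub0r opprK.
  by rewrite mulrN mulrC -subrX1 opprB.
have -> : p = (\sum_(i < T) v ^+ i) * (p * w) + p * v ^+ T.
  by rewrite mulrCA sumw -mulrDr subrK mulr1.
apply: near_idealD; first exact: near_idealM.
by apply: near_ideal_order; apply: order_geMl; apply: order_geX.
Qed.

Variable (d : 'I_r -> nat).
Hypothesis f_homog : forall i, P i -> f i \is (d i).-homog.

Lemma pihomog_ideal e p : ideal_gen P f p -> ideal_gen P f (pihomog mdeg e p).
Proof.
apply: (ideal_gen_sub (Q := fun x => ideal_gen P f (pihomog mdeg e x))).
- by rewrite pihomog0; apply: ideal_gen0.
- by move=> x y hx hy; rewrite pihomogD; apply: ideal_genD.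
move=> x i Pi; rewrite {1}(pihomog_partitionE (leqnn (msize x))).
rewrite mulr_suml (raddf_sum (pihomog mdeg e)); apply: ideal_gen_sum => j _ /=.
have h : pihomog mdeg j x * f i \is (j + d i).-homog.
  by apply: dhomogM; [apply: pihomogP | apply: f_homog].
case: (eqVneq (j + d i)%N e) h => [<-|ne] h.
  by rewrite pihomog_dE //; apply: ideal_genM; apply: ideal_gen_mem.
by rewrite (pihomog_ne0 ne h); apply: ideal_gen0.
Qed.

(** A homogeneous ideal is closed for the topology of the irrelevant ideal:
    below the degree bound [msize p], the components of [p] are those of an
    element of the ideal. *)
Lemma near_ideal_closed p : (forall T, near_ideal P f T p) -> ideal_gen P f p.
Proof.
move=> /(_ (msize p))[q hq h]; rewrite (pihomog_partitionE (leqnn (msize p))).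
apply: ideal_gen_sum => e _; have := pihomog_ideal e h.
rewrite pihomogB [X in _ - X](_ : _ = 0) ?subr0 //.
rewrite /pihomog big1 // => m /eqP me.
by rewrite hq ?scale0r // me.
Qed.

End Near.
End MAdic.

(** * Regularity and minimality *)
Section Regularity.
Variables (k : closedFieldType) (n : nat).
Local Notation S := {mpoly k[n.+1]}.
Local Notation T := {mpoly {mpoly k[n.+1]}[n.+1]}.
Implicit Types (f g : 'I_n.+1 -> S) (p q : S).

(** For forms of positive degree, the ideal is primary to the irrelevant ideal
    exactly when it contains a power of every variable. *)
Definition mprimary f := exists N, forall l, ideal_gen predT f ('X_l ^+ N.+1).

Lemma mprimary_radical f g (e : nat) :
  mprimary f -> (forall i, ideal_gen predT g (f i ^+ e)) -> mprimary g.
Proof.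
move=> [N hN] hg.
have /fin_all_exists[M hM] l :
    exists M, ideal_gen predT g (('X_l ^+ N.+1) ^+ M).
  by apply: radical_gen (hN l) => i _; apply: hg.
exists (N.+1 * \max_l M l)%N => l.
rewrite exprS exprM -(subnK (leq_bigmax l)) exprD mulrA.
by apply: ideal_genM.
Qed.

(** Replace [f i] by its power [f i ^+ e.+1]. The Bezoutian is then multiplied
    by the sum of the [f_i(x)^(e-c) f_i(y)^c]. A residue functional [phi] for
    the new family kills the [f j] with [j != i], hence also
    [p(x) f_i(x)^(e-c)] as soon as [c < e]. In the reproduction formula for [p]
    only the term [c = e] survives, and it is a multiple of [f i ^+ e]. *)
Lemma colon_power f i e p :
  (forall j, (f j)@_0%MM = 0) -> mprimary f ->
  ideal_gen (predC1 i) f (p * f i) ->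
  exists w b, w@_0%MM = 1 /\ ideal_gen (predC1 i) f (p * w - b * f i ^+ e).
Proof.
move=> f0 hf hp; have [A hA] := bezout_matrix_exists f.
pose f' j := if j == i then f i ^+ e.+1 else f j.
pose G : T := \sum_(c < e.+1) (f i)%:MP ^+ (e - c) * outer (f i) ^+ c.
pose A' : 'M[T]_n.+1 := diag_mx (\row_j if j == i then G else 1) *m A.
have detA' : \det A' = G * \det A.
  rewrite det_mulmx det_diag (bigD1 i) //= big1 ?mulr1 => [|j nji].
    by rewrite mxE eqxx.
  by rewrite mxE (negPf nji).
have hA' : bezout_matrix f' A'.
  move=> j; rewrite /f'.
  rewrite (eq_bigr (fun l =>
    (if j == i then G else 1) * (A j l * bdiff 'X_l))).
    rewrite -mulr_sumr -hA; case: eqP => [->|_]; last by rewrite mul1r.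
    by rewrite mulrC /bdiff /outer !rmorphXn /= subrXX.
  by move=> l _; rewrite /A' mul_diag_mx !mxE mulrA.
have f'0 j : (f' j)@_0%MM = 0.
  by rewrite /f'; case: eqP => // _; rewrite rmorphXn /= f0 expr0n.
have [N hN] : mprimary f'.
  apply: (mprimary_radical (e := e.+1)) hf _ => j.
  case: (eqVneq j i) => [->|nji].
    by have := @ideal_gen_mem _ _ _ predT f' i isT; rewrite /f' eqxx.
  rewrite exprSr; apply: ideal_genM.
  by have := @ideal_gen_mem _ _ _ predT f' j isT; rewrite /f' (negPf nji).
have [phi [phi0 phi1]] :=
  exists_residue (fun j => bezout_matrix_coef0 hA' (f'0 j)) hN.
have kill (R : T) x :
    ideal_gen (predC1 i) f x -> map_mpoly phi (R * x%:MP) = 0.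
  apply: (ideal_gen_sub (Q := fun x => map_mpoly phi (R * x%:MP) = 0)).
  - by rewrite mpolyC0 mulr0 raddf0.
  - by move=> y z hy hz; rewrite mpolyCD mulrDr raddfD /= hy hz addr0.
  move=> y j nji; rewrite mpolyCM mulrA; apply: map_kill => z.
  by have := phi0 z j; rewrite /f' (negPf nji).
pose w := map_mpoly phi (\det A').
pose Q x := exists b, ideal_gen (predC1 i) f (x - b * f i ^+ e).
have QD x y : Q x -> Q y -> Q (x + y).
  move=> [b hb] [c hc]; exists (b + c).
  by rewrite mulrDl opprD addrACA; apply: ideal_genD.
have Q0 : Q 0 by exists 0; rewrite mul0r subr0; apply: ideal_gen0.
suff [b hb] : Q (p * w).
  exists w, b; split => //.
  by rewrite /w mcoeff_map_mpoly /= -phi1 det_map_mx.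
(* The first summand is in the ideal of [f'] by the reproduction formula; the
   second one is computed by expanding [G]. *)
have -> : p * w = (p * w - map_mpoly phi (p%:MP * \det A'))
                  + map_mpoly phi (p%:MP * \det A') by rewrite subrK.
apply: (QD).
  apply: ideal_gen_sub (bezout_reproduce p hA' phi0) => // x j _; rewrite /f'.
  case: (eqVneq j i) => [_|nji].
    by exists (x * f i); rewrite exprS mulrA subrr; apply: ideal_gen0.
  by exists 0; rewrite mul0r subr0; apply: ideal_genM; apply: ideal_gen_mem.
have -> : p%:MP * \det A' =
    \sum_(c < e.+1) outer (f i ^+ c) * (\det A * (p * f i ^+ (e - c))%:MP).
  rewrite detA' mulr_suml mulr_sumr; apply: eq_bigr => c _.
  rewrite /outer mpolyCM !rmorphXn /=.
  rewrite [LHS]mulrA [X in X * _ = _]mulrA -[LHS]mulrA [LHS]mulrCA.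
  by congr (_ * _); rewrite mulrC.
rewrite (raddf_sum (map_mpoly phi)); apply: big_ind => // c _.
rewrite /= map_outer; case: (ltnP c e) => [lt_ce|le_ec].
  rewrite kill ?mulr0 // -(prednK (n := e - c)) ?subn_gt0 // exprS mulrA.
  rewrite mulrC.
  exact: ideal_genM.
have -> : c = e :> nat by apply/eqP; rewrite eqn_leq le_ec -ltnS ltn_ord.
(* The surviving term [c = e]. *)
exists (map_mpoly phi (\det A * (p * f i ^+ (e - e))%:MP)).
by rewrite mulrC subrr; apply: ideal_gen0.
Qed.

(** If [f i] were in the ideal of the others, [colon_power] with [p = 1] would
    put an element with constant term [1] into an ideal of elements without
    constant term. *)
Lemma mprimary_minimal f i :
  (forall j, (f j)@_0%MM = 0) -> mprimary f -> ~ ideal_gen (predC1 i) f (f i).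
Proof.
move=> f0 hf; rewrite -[X in ideal_gen _ _ X]mul1r => /(colon_power 1 f0 hf).
move=> [w [b [w1 []]]] a; rewrite mul1r => /(congr1 (mcoeff 0%MM)) /eqP.
rewrite raddf_sum /= big1 => [|j _]; last by rewrite rmorphM /= f0 mulr0.
by rewrite mcoeffB expr1 rmorphM /= f0 mulr0 subr0 w1 oner_eq0.
Qed.

(** Apply [colon_power] to the family in which the forms after [f i] are raised
    to the power [e.+1]: everything beyond the ideal of the forms before [f i]
    then has order at least [e], and [e] is arbitrary. *)
Lemma mprimary_regular f (d : 'I_n.+1 -> nat) :
  (forall j, f j \is (d j).-homog) -> (forall j, (0 < d j)%N) -> mprimary f ->
  regular_sequence f.
Proof.
move=> fd d0 hf.
have f0 j : (f j)@_0%MM = 0 by apply: dhomog_coef0 (d0 j) (fd j).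
split; last first.
  move=> [a] /(congr1 (mcoeff 0%MM)) /eqP.
  rewrite mcoeff1 eqxx raddf_sum big1 /= ?oner_eq0 // => j _.
  by rewrite rmorphM /= f0 mulr0.
move=> i p hp; apply: (near_ideal_closed (fun j _ => fd j)) => e.
pose g (j : 'I_n.+1) := if (j <= i)%N then f j else f j ^+ e.+1.
have g0 j : (g j)@_0%MM = 0.
  by rewrite /g; case: leqP => // _; rewrite rmorphXn /= f0 expr0n.
have hg : mprimary g.
  apply: (mprimary_radical (e := e.+1)) hf _ => j.
  have := @ideal_gen_mem _ _ _ predT g j isT.
  by rewrite {2}/g; case: leqP => // _ h; rewrite exprSr; apply: ideal_genM.
have gi : g i = f i by rewrite /g leqnn.
have hpg : ideal_gen (predC1 i) g (p * g i).
  rewrite gi; apply: ideal_gen_trans hp => j lt_ji.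
  have {1}-> : f j = g j by rewrite /g (ltnW lt_ji).
  by apply: ideal_gen_mem; apply: contraTneq lt_ji => ->; rewrite /= ltnn.
have [w [b [w1 hw]]] := colon_power e.+1 g0 hg hpg.
apply: (near_ideal_unit w1).
have -> : p * w = (p * w - b * g i ^+ e.+1) + b * g i ^+ e.+1 by rewrite subrK.
have order_e q : q@_0%MM = 0 -> order_ge e (q ^+ e.+1).
  by move=> q0; rewrite exprS; apply: order_geMl; apply: order_geX.
apply: near_idealD; last first.
  by apply: near_ideal_order; apply: order_geMl; apply: order_e.
apply: ideal_gen_sub hw => [|x y|x j nji].
- by apply: near_ideal_order; apply: order_ge0.
- exact: near_idealD.
apply: near_idealM; rewrite /g; case: leqP => [le_ji|_].
  apply: near_ideal_mem; apply: ideal_gen_mem.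
  rewrite /= ltn_neqAle le_ji andbT; apply: contra_neq nji => h.
  exact: val_inj.
by apply: near_ideal_order; apply: order_e.
Qed.

End Regularity.

(** * Apolarity *)

(** The coefficient of [m] in [apolar f g], written over an arbitrary ring so
    that it can be computed with indeterminate coefficients; [K] bounds the
    support of [f]. *)
Definition apolar_coef (R : comRingType) n K (m : 'X_{1..n.+1})
    (f g : {mpoly R[n.+1]}) : R :=
  \sum_(m' : 'X_{1..n.+1 < K})
     f@_m' * g@_(m' + m)%MM
       * (\prod_(i < n.+1) ((m' + m)%MM i) ^_ (m' i))%N%:R.

Section Apolarity.
Variables (k : closedFieldType) (n : nat).
Local Notation S := {mpoly k[n.+1]}.
Implicit Types (f g p q H : S).

Lemma apolarwE f g K : (msize f <= K)%N ->
  apolar f g = \sum_(m : 'X_{1..n.+1 < K}) f@_m *: mderivm m g.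
Proof.
move=> le_fK; pose I : subFinType _ := 'X_{1..n.+1 < K}.
rewrite /apolar (big_mksub I) /=; first last.
- by move=> x /msize_mdeg_lt /leq_trans /(_ le_fK).
- by rewrite msupp_uniq.
by rewrite big_rmcond //= => m /memN_msupp_eq0 ->; rewrite scale0r.
Qed.

Lemma apolarDl p q g : apolar (p + q) g = apolar p g + apolar q g.
Proof.
pose K := maxn (msize (p + q)) (maxn (msize p) (msize q)).
have /and3P[h1 h2 h3] :
    [&& (msize (p + q) <= K)%N, (msize p <= K)%N & (msize q <= K)%N].
  by rewrite /K !leq_max !leqnn !orbT.
rewrite !(@apolarwE _ _ K) // -big_split; apply: eq_bigr => m _ /=.
by rewrite mcoeffD scalerDl.
Qed.

Lemma apolarZl c p g : apolar (c *: p) g = c *: apolar p g.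
Proof.
pose K := maxn (msize (c *: p)) (msize p).
have /andP[h1 h2] : (msize (c *: p) <= K)%N && (msize p <= K)%N.
  by rewrite /K !leq_max !leqnn !orbT.
rewrite !(@apolarwE _ _ K) // scaler_sumr; apply: eq_bigr => m _ /=.
by rewrite mcoeffZ scalerA.
Qed.

Lemma apolar0l g : apolar 0 g = 0.
Proof. by rewrite /apolar msupp0 big_nil. Qed.

Lemma apolarZr c f g : apolar f (c *: g) = c *: apolar f g.
Proof.
rewrite /apolar scaler_sumr; apply: eq_bigr => m _.
by rewrite linearZ /= !scalerA mulrC.
Qed.

Lemma apolarX m g : apolar 'X_[m] g = mderivm m g.
Proof. by rewrite /apolar msuppX big_seq1 mcoeffX eqxx scale1r. Qed.

Lemma apolar0r f : apolar f 0 = 0.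
Proof. by rewrite /apolar big1 // => m _; rewrite raddf0 scaler0. Qed.

Lemma apolarM p q g : apolar (p * q) g = apolar p (apolar q g).
Proof.
elim/mpolyind: p => [|c m p _ _ IH]; first by rewrite mul0r !apolar0l.
rewrite mulrDl !apolarDl IH -scalerAl !apolarZl; congr (_ *: _ + _).
elim/mpolyind: q {IH} => [|e m' q _ _ IH].
  by rewrite mulr0 !apolar0l apolar0r.
rewrite mulrDr !apolarDl IH -scalerAr !apolarZl -mpolyXD !apolarX addmC.
rewrite mderivmDm.
by rewrite raddfD /= linearZ.
Qed.

Lemma mcoeff_apolar f g m K :
  (msize f <= K)%N -> (apolar f g)@_m = apolar_coef K m f g.
Proof.
move=> h; rewrite (apolarwE _ h) raddf_sum; apply: eq_bigr => m' _ /=.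
by rewrite mcoeffZ mcoeff_mderivm mulr_natr mulrnAr.
Qed.

Lemma apolarXn_eq0 l N H : (msize H <= N)%N -> apolar ('X_l ^+ N) H = 0.
Proof.
move=> h; rewrite mpolyXn apolarX; apply/mpolyP => m.
rewrite mcoeff_mderivm mcoeff0 memN_msupp_eq0 ?mul0rn //.
apply: msize_mdeg_ge; apply: leq_trans h _.
by rewrite mdegD mdegMn mdeg1 mul1n leq_addr.
Qed.

Definition contraction H (m : 'X_{1..n.+1}) p : k := (apolar p H)@_m.

Lemma contraction_is_scalar H m : scalar (contraction H m).
Proof.
by move=> c p q; rewrite /contraction apolarDl apolarZl mcoeffD mcoeffZ.
Qed.

HB.instance Definition _ H m :=
  GRing.isLinear.Build k S k *%R (contraction H m) (contraction_is_scalar H m).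

End Apolarity.

(** * The Jacobian determinant *)
Section Jacobian.
Variables (k : closedFieldType) (n : nat).
Local Notation S := {mpoly k[n.+1]}.
Local Notation T := {mpoly {mpoly k[n.+1]}[n.+1]}.
Hypothesis kchar0 : [pchar k] =i pred0.

Lemma euler (f : S) d : f \is d.-homog -> \sum_j mderiv j f * 'X_j = d%:R *: f.
Proof.
move=> fd; apply/mpolyP => m; rewrite raddf_sum mcoeffZ /=.
rewrite (eq_bigr (fun j => f@_m * (m j)%:R)); last first.
  move=> j _; case: (posnP (m j)) => [mj0|mj0].
    by rewrite -['X_j]expr1 mcoeff_mulXn_small ?mj0 // mulr0.
  have le1 : (U_(j) <= m)%MM by rewrite lep1mP -lt0n.
  rewrite -{1}(submK le1) addmC mcoeffMX mcoeff_mderiv submK //.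
  by rewrite mnmBE mnm1E eqxx subn1 prednK // mulr_natr.
rewrite -mulr_sumr -natr_sum -mdegE mulrC.
have [->|nz] := eqVneq f@_m 0; first by rewrite !mulr0.
congr (_%:R * _); apply/eqP; apply: contraNT nz => ne.
by rewrite (dhomog_nemf_coeff fd ne).
Qed.

Lemma jacobian_scale (f : 'I_n.+1 -> S) (c : 'I_n.+1 -> k) :
  \det (jacobian (fun i => c i *: f i)) = (\prod_i c i) *: \det (jacobian f).
Proof.
have -> : jacobian (fun i => c i *: f i) =
    diag_mx (\row_i (c i)%:MP) *m jacobian f.
  by apply/matrixP => i j; rewrite mul_diag_mx !mxE mul_mpolyC linearZ.
rewrite det_mulmx det_diag -mul_mpolyC rmorph_prod /=; congr (_ * _).
by apply: eq_bigr => i _; rewrite mxE.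
Qed.

(** By Euler's formula this is a transition matrix from [f] to the variables. *)
Definition euler_mx (d : 'I_n.+1 -> nat) (f : 'I_n.+1 -> S) : 'M[S]_n.+1 :=
  \matrix_(i, j) ((d i)%:R^-1 *: mderiv j (f i)).

Lemma det_euler_mx d f :
  \det (euler_mx d f) = (\prod_i (d i)%:R^-1) *: \det (jacobian f).
Proof.
rewrite -jacobian_scale; congr (\det _); apply/matrixP => i j.
by rewrite !mxE linearZ.
Qed.

Variables (d : 'I_n.+1 -> nat) (f : 'I_n.+1 -> S).
Hypothesis d_gt0 : forall i, (0 < d i)%N.
Hypothesis f_homog : forall i, f i \is (d i).-homog.

Lemma natd_neq0 i : (d i)%:R != 0 :> k.
Proof. by have /pcharf0P-> := kchar0; rewrite -lt0n. Qed.

Lemma homog_coef0 i : (f i)@_0%MM = 0.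
Proof. exact: dhomog_coef0 (d_gt0 i) (f_homog i). Qed.

Lemma euler_mxP i : f i = \sum_j euler_mx d f i j * 'X_j.
Proof.
rewrite (eq_bigr (fun j => (d i)%:R^-1 *: (mderiv j (f i) * 'X_j))); last first.
  by move=> j _; rewrite mxE scalerAl.
by rewrite -scaler_sumr (euler (f_homog i)) scalerA mulVf ?scale1r // natd_neq0.
Qed.

Definition subst_diff : S -> T :=
  mmap (@mpolyC n.+1 S \o @mpolyC n.+1 k) (fun j => bdiff 'X_j).

HB.instance Definition _ := GRing.RMorphism.copy subst_diff subst_diff.

Lemma subst_diffX j : subst_diff 'X_j = bdiff 'X_j.
Proof. by rewrite /subst_diff mmapX mmap1U. Qed.

Lemma subst_diff_coef0 p : (subst_diff p)@_0%MM = p.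
Proof.
rewrite /subst_diff /mmap raddf_sum [RHS]mpolyE; apply: eq_bigr => m _ /=.
rewrite rmorphM /= mcoeffC eqxx mulr1 mul_mpolyC; congr (_ *: _).
rewrite /mmap1 rmorph_prod mpolyXE_id; apply: eq_bigr => j _ /=.
by rewrite rmorphXn /= bdiff_coef0 // mcoeffX mnm1_eq0.
Qed.

(** Any Bezout matrix [A] specialises at [y = 0] to a transition matrix, so
    [euler_mx d f] minus this specialisation has rows [r] that are syzygies of
    the variables. Substituting [x - y] for [x] turns these into syzygies of the
    [x_j - y_j]; adding them to [A] keeps it a Bezout matrix and corrects its
    value at [y = 0]. *)
Lemma euler_bezout_matrix :
  exists2 A, bezout_matrix f A & map_mx (mcoeff 0%MM) A = euler_mx d f.
Proof.
have [A hA] := bezout_matrix_exists f.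
pose r := euler_mx d f - map_mx (mcoeff 0%MM) A.
exists (A + map_mx subst_diff r); last first.
  apply/matrixP => i j; have rE : r i j = euler_mx d f i j - (A i j)@_0%MM.
    by rewrite /r !mxE.
  by rewrite mxE mxE [X in _ + X]mxE mcoeffD subst_diff_coef0 rE addrC subrK.
move=> i; rewrite (eq_bigr (fun j =>
    A i j * bdiff 'X_j + subst_diff (r i j * 'X_j))).
  2: by move=> j _; rewrite !mxE mulrDl rmorphM /= subst_diffX.
rewrite big_split /= -hA -[LHS]addr0; congr (_ + _).
rewrite -(raddf_sum subst_diff) /= -[LHS](rmorph0 subst_diff) /=.
congr subst_diff.
rewrite (eq_bigr (fun j =>
    euler_mx d f i j * 'X_j - (map_mx (mcoeff 0%MM) A) i j * 'X_j)).
  by rewrite sumrB -euler_mxP -(bezout_matrix_coef0 hA (homog_coef0 i)) subrr.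
by move=> j _; rewrite !mxE mulrBl.
Qed.

(** The Jacobian determinant is a nonzero multiple of a transition determinant,
    on which a residue functional is not zero. *)
Lemma jacobian_notin_ideal :
  mprimary f -> ~ ideal_gen predT f (\det (jacobian f)).
Proof.
move=> [N hN]; have [phi [phi0 phi1]] := exists_residue euler_mxP hN.
move=> [a ha]; move/eqP: phi1.
rewrite det_euler_mx linearZ /= ha (raddf_sum phi) /=.
rewrite [X in _ * X]big1 => [|i _]; last exact: phi0.
by rewrite mulr0 eq_sym oner_eq0.
Qed.

(** Take for [phi] a coefficient of [apolar p H] at which the contraction by the
    Jacobian determinant is not zero. For [p] in the annihilator the right-hand
    side of the reproduction formula vanishes, so [p * w] is in the ideal, and
    the constant term of [w] is [phi] of the Jacobian determinant up to a
    nonzero scalar. *)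
Lemma annihilator_eq_ideal (H : S) :
  (forall i, apolar (f i) H = 0) -> apolar (\det (jacobian f)) H != 0 ->
  forall p, annihilator H p <-> ideal_gen predT f p.
Proof.
move=> fH JH p; split; last first.
  apply: (ideal_gen_sub (Q := annihilator H)); rewrite /annihilator.
  - exact: apolar0l.
  - by move=> x y hx hy; rewrite apolarDl hx hy addr0.
  - by move=> x i _; rewrite apolarM fH apolar0r.
move=> pH; have [m Jm] : exists m, (apolar (\det (jacobian f)) H)@_m != 0.
  by exists (mlead (apolar (\det (jacobian f)) H)); rewrite mleadc_eq0.
pose phi : {scalar S} := contraction H m.
have [A hA A0] := euler_bezout_matrix.
have phi0 x i : phi (x * f i) = 0.
  by rewrite /= /contraction apolarM fH apolar0r mcoeff0.
have phip x : phi (x * p) = 0.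
  by rewrite /= /contraction apolarM pH apolar0r mcoeff0.
pose w := map_mpoly phi (\det A); pose c := w@_0%MM.
have c0 : c != 0.
  rewrite /c /w mcoeff_map_mpoly -det_map_mx A0 det_euler_mx /=.
  rewrite /contraction apolarZl mcoeffZ.
  apply: mulf_neq0 => //; apply/prodf_neq0 => i _.
  by rewrite invr_eq0 natd_neq0.
have pw : ideal_gen predT f (p * w).
  have := bezout_reproduce p hA phi0.
  by rewrite [p%:MP * _]mulrC (map_kill _ phip) subr0.
apply: (near_ideal_closed (fun i _ => f_homog i)) => e.
apply: (@near_ideal_unit _ _ _ _ _ _ _ (c^-1 *: w)).
  by rewrite mcoeffZ mulVf.
apply: near_ideal_mem; rewrite -scalerAr -mul_mpolyC.
exact: ideal_genM.
Qed.

Lemma annihilator_mprimary (H : S) :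
  (forall p, annihilator H p <-> ideal_gen predT f p) -> mprimary f.
Proof.
move=> h; exists (msize H) => l; apply/h; rewrite /annihilator.
exact: apolarXn_eq0.
Qed.

Lemma complete_intersection_annihilator (H : S) :
  (forall i, apolar (f i) H = 0) -> apolar (\det (jacobian f)) H != 0 ->
  complete_intersection d (annihilator H).
Proof.
move=> fH JH; have hI := annihilator_eq_ideal fH JH.
have hf := annihilator_mprimary hI.
have min_f i := mprimary_minimal (i := i) homog_coef0 hf.
exists f; split.
- move=> i; split=> //; apply/eqP => fi0; apply: (min_f i).
  by rewrite fi0; apply: ideal_gen0.
- exact: mprimary_regular.
- split=> // i h; apply: (min_f i); apply/h/hI.
  exact: ideal_gen_mem.
Qed.

End Jacobian.

(** * Fibers of the incidence sets *)
Section Fibers.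
Variables (k : closedFieldType) (n : nat).
Local Notation S := {mpoly k[n.+1]}.

Lemma represents_point (V : vectType k) (v : V) (v0 : v != 0) :
  represents (point v0) v.
Proof. by split. Qed.

Lemma represents_scale (V : vectType k) (x : projective V) (v w : V) :
  represents x v -> represents x w -> exists2 c, c != 0 & w = c *: v.
Proof.
move=> [v0 xv] [w0 xw].
have /vlineP[c wE] : w \in <[v]>%VS by rewrite -xv xw memv_line.
by exists c => //; apply: contraNneq w0 => c0; rewrite wE c0 scale0r.
Qed.

Lemma representsZ (V : vectType k) (x : projective V) (v : V) c :
  c != 0 -> represents x v -> represents x (c *: v).
Proof.
move=> c0 [v0 xv]; have cv0 : c *: v != 0 by rewrite scaler_eq0 negb_or c0.
split=> //; rewrite xv; apply/vspaceP => w; apply/vlineP/vlineP => -[a ->].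
  by exists (a / c); rewrite scalerA divfK.
by exists (a * c); rewrite scalerA.
Qed.

Lemma represents_exists (V : vectType k) (x : projective V) :
  exists v, represents x v.
Proof.
exists (vpick (val x)); case: x => L /= dL1; have /eqP dL := dL1.
have L0 : L != 0%VS by rewrite -dimv_eq0 dL.
split=> /=; first by rewrite vpick0.
symmetry; apply/eqP; rewrite eqEdim -memvE memv_pick dL.
by rewrite dim_vline vpick0 L0.
Qed.

Lemma hformZ e (c : k) (g : hform k n e) :
  mpoly_of_dhomog (c *: g) = c *: mpoly_of_dhomog g.
Proof. by []. Qed.

Lemma eq_jacobian (f g : 'I_n.+1 -> S) : f =1 g -> jacobian f = jacobian g.
Proof. by move=> fg; apply/matrixP => i j; rewrite !mxE fg. Qed.

Variables (d : 'I_n.+1 -> nat) (Res : {mpoly k[#|coef_index d|]}).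
Local Notation hforms := (forall i, hform k n (d i)).

Definition generating_tuple (f : hforms) (H : S) :=
  [/\ Res.@[coefficients f] != 0,
      forall i, apolar (mpoly_of_dhomog (f i)) H = 0
    & apolar (\det (jacobian (fun i => mpoly_of_dhomog (f i)))) H != 0].

Lemma generating_tuple_neq0 f H i : generating_tuple f H -> f i != 0.
Proof.
move=> [_ _]; apply: contraNneq => fi0; rewrite (expand_det_row _ i) big1.
  by rewrite apolar0l.
by move=> j _; rewrite mxE fi0 /= raddf0 mul0r.
Qed.

(** Both conditions are insensitive to the choice of representatives:
    rescaling the [f i] and [H] multiplies the contraction of [H] by the
    Jacobian determinant by a nonzero scalar. *)
Lemma fiber_not_included (h : projective (hform k n (socle_degree d)))
    (H : hform k n (socle_degree d)) :
  represents h H ->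
  ~ included (fiber (Z1 Res) h) (fiber (@Z2 k n d) h) <->
  exists f, generating_tuple f (mpoly_of_dhomog H).
Proof.
move=> hH; split=> [hn|[f gf]].
  have [e he] := not_all_ex_not _ _ hn.
  have [[[f [G [fe Ge Rf fG]]] eh] nZ2] := imply_to_and _ _ he.
  rewrite eh in Ge.
  have [c c0 HE] := represents_scale Ge hH.
  exists f; split=> // [i|].
    by rewrite HE hformZ apolarZr fG scaler0.
  apply/eqP; rewrite HE hformZ apolarZr => /eqP; rewrite scaler_eq0 (negPf c0).
  move=> /eqP JG; apply: nZ2; split=> //.
  by exists f, G; split=> //; rewrite eh.
pose e : EE k d := (fun i => point (generating_tuple_neq0 i gf), h).
have [Rf fH Jf] := gf; move=> /(_ e)[].
  split=> //; exists f, H; split=> // i; exact: represents_point.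
move=> [g [G [ge Ge JG]]] _; move: Jf; apply/negP; rewrite negbK.
have /fin_all_exists2[c c0 fE] i :=
  represents_scale (ge i) (represents_point (generating_tuple_neq0 i gf)).
have [b b0 HE] := represents_scale Ge hH.
rewrite (@eq_jacobian _ (fun i => c i *: mpoly_of_dhomog (g i))) => [|i].
  by rewrite jacobian_scale apolarZl HE hformZ apolarZr JG !scaler0.
by rewrite fE hformZ.
Qed.

End Fibers.

Section Criterion.
Variables (k : closedFieldType) (kchar0 : [pchar k] =i pred0).
Variables (n : nat) (d : 'I_n.+1 -> nat) (d_gt0 : forall i, (0 < d i)%N).
Variables (Res : {mpoly k[#|coef_index d|]}) (HRes : is_resultant Res).

Lemma mprimary_common_zero (f : forall i, hform k n (d i)) :
  mprimary (fun i => mpoly_of_dhomog (f i)) -> ~ common_zero f.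
Proof.
move=> [N hN] [x [[l xl] fx]]; have [a] := hN l.
move=> /(congr1 (meval x)); rewrite rmorphXn /= mevalXU raddf_sum /= big1.
  by move/eqP; rewrite expf_eq0 (negPf xl) andbF.
by move=> i _; rewrite mevalM fx mulr0.
Qed.

(** An annihilator contains powers of the variables. If it is generated by forms
    [f], this excludes common zeros of [f], so that the resultant is nonzero,
    and it puts the Jacobian determinant outside the ideal. The converse is
    [complete_intersection_annihilator]. *)
Lemma complete_intersection_iff (H : {mpoly k[n.+1]}) :
  complete_intersection d (annihilator H) <->
  exists f, generating_tuple Res f H.
Proof.
split=> [[f [fd _ [hI _]]]|[f [_ fH JH]]]; last first.
  apply: complete_intersection_annihilator fH JH => // i.
  exact: dhomog_is_dhomog.
have fhom i : f i \is (d i).-homog by have [] := fd i.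
pose F i : hform k n (d i) := DHomog (fhom i).
have hf : mprimary f by apply: annihilator_mprimary hI.
have F0 i : F i != 0.
  have [+ _] := fd i; apply: contraNneq.
  by move=> /(congr1 (@mpoly_of_dhomog _ _ _)) /= ->.
exists F; split=> [|i|].
- by apply/eqP => /(HRes.2 F F0); apply: mprimary_common_zero.
- by apply/hI; apply: ideal_gen_mem.
- by apply/eqP => /hI; apply: (jacobian_notin_ideal kchar0 d_gt0 fhom hf).
Qed.

End Criterion.

(** * Kernels through minors *)
Section KernelMinors.

(** If the minor of [C] with rows [f] and columns [g] is nonzero and of maximal
    size, then [C] is the product of its columns [g], the inverse of the
    submatrix and its rows [f]. Clearing the denominator, this matrix is the
    minor times a projection of the row space onto the left kernel of [C], with
    entries polynomial in those of [C]. *)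
Definition kernel_proj (R : comRingType) (N M r : nat) (C : 'M[R]_(N, M))
    (f : 'I_r -> 'I_N) (g : 'I_r -> 'I_M) : 'M[R]_N :=
  (\det (mxsub f g C))%:M
    - colsub g C *m \adj (mxsub f g C) *m rowsub f 1%:M.

Lemma map_kernel_proj (R R' : comRingType) (phi : {rmorphism R -> R'})
    (N M r : nat) (C : 'M[R]_(N, M)) (f : 'I_r -> 'I_N) (g : 'I_r -> 'I_M) :
  map_mx phi (kernel_proj C f g) = kernel_proj (map_mx phi C) f g.
Proof.
rewrite /kernel_proj map_mxB map_scalar_mx -det_map_mx !map_mxM map_mx_adj.
by rewrite !map_mxsub map_mx1.
Qed.

Variables (F : fieldType) (N M : nat) (C : 'M[F]_(N, M)).

Lemma minor_rank r (f : 'I_r -> 'I_N) (g : 'I_r -> 'I_M) :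
  \det (mxsub f g C) != 0 -> (r <= \rank C)%N.
Proof.
rewrite -unitfE -unitmxE => /mxrank_unit <-.
have := mxrankS (rowsub_sub f C); apply: leq_trans.
rewrite mxsubcr -mxrank_tr trmx_mxsub -[X in (_ <= X)%N]mxrank_tr.
by apply: mxrankS; apply: rowsub_sub.
Qed.

Lemma rank_minor :
  exists f : 'I_(\rank C) -> 'I_N, exists g : 'I_(\rank C) -> 'I_M,
  \det (mxsub f g C) != 0.
Proof.
have full : row_full (rowsub (maxrankfun C) C)^T.
  by rewrite /row_full mxrank_tr; apply: maxrowsub_free.
move: (fullrankfun full : _ -> _) (fullrowsub_unit full) => g unit_g.
exists (maxrankfun C), g.
by rewrite -unitfE -unitmxE mxsubcr -unitmx_tr trmx_mxsub.
Qed.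

Variables (r : nat) (f : 'I_r -> 'I_N) (g : 'I_r -> 'I_M).

Lemma kernel_proj_id (u : 'rV_N) :
  u *m C = 0 -> u *m kernel_proj C f g = \det (mxsub f g C) *: u.
Proof.
move=> uC; rewrite /kernel_proj mulmxBr mul_mx_scalar !mulmxA mulmx_colsub uC.
rewrite (_ : colsub g 0 = 0) ?mul0mx ?subr0 //.
by apply/matrixP => i j; rewrite !mxE.
Qed.

Lemma kernel_proj_kernel :
  (\rank C <= r)%N -> \det (mxsub f g C) != 0 -> kernel_proj C f g *m C = 0.
Proof.
move=> le_rC minor0.
have row_r : \rank (rowsub f C) = r.
  apply/eqP; rewrite eqn_leq rank_leq_row /=.
  have := minor0; rewrite -unitfE -unitmxE => /mxrank_unit {1}<-.
  rewrite mxsubcr -mxrank_tr trmx_mxsub -[X in (_ <= X)%N]mxrank_tr.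
  by apply: mxrankS; apply: rowsub_sub.
have /submxP[D CD] : (C <= rowsub f C)%MS.
  by rewrite -(geq_leqif (mxrank_leqif_sup (rowsub_sub f C))) row_r.
rewrite /kernel_proj mulmxBl mul_scalar_mx -!mulmxA -rowsubE.
have -> : colsub g C = D *m mxsub f g C by rewrite {1}CD -mulmx_colsub -mxsubcr.
rewrite -!mulmxA [X in D *m X]mulmxA mul_mx_adj mul_scalar_mx.
by rewrite -scalemxAr -CD subrr.
Qed.

End KernelMinors.

(** * Zariski closed sets and constructibility *)
Section Zariski.
Variables (k : closedFieldType) (n e : nat).
Local Notation a := #|monomial n e|.
Local Notation PN := (projective (hform k n e)).
Implicit Types (x : PN) (g : hform k n e) (p : {mpoly k[a]}).

(** Otherwise ['X * P + 1] would be a nonconstant polynomial without roots: it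
    is [1] at every point. *)
Lemma poly_eq0_units (P : {poly k}) : (forall c, c != 0 -> P.[c] = 0) -> P = 0.
Proof.
move=> hP; apply/eqP; apply: contraT => P0.
have [c rc] : exists c, root ('X * P + 1) c.
  (* The size is not 1, because ['X * P] has positive degree. *)
  apply/closed_rootP; rewrite size_polyDl.
    by rewrite mulrC size_mulX // eqSS size_poly_eq0.
  by rewrite mulrC size_mulX // size_poly1 ltnS lt0n size_poly_eq0.
move: rc; rewrite rootE hornerD hornerM hornerX hornerC.
have [->|/hP->] := eqVneq c 0; first by rewrite mul0r add0r oner_eq0.
by rewrite mulr0 add0r oner_eq0.
Qed.

Lemma meval_homog (N i : nat) (p : {mpoly k[N]}) (v : 'I_N -> k) c :
  p \is i.-homog -> p.@[fun t => c * v t] = c ^+ i * p.@[v].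
Proof.
move=> /dhomogP hp; rewrite !mevalE mulr_sumr big_seq [RHS]big_seq.
apply: eq_bigr => m /hp <-; rewrite mulrCA; congr (_ * _).
under eq_bigr => j _ do rewrite exprMn.
by rewrite big_split /= -expr_sum /= mdegE.
Qed.

(** The value of [p] at a multiple [c] of [v] is a polynomial in [c] whose
    coefficients are the values at [v] of the homogeneous components. *)
Lemma homog_components_vanish (N : nat) (p : {mpoly k[N]}) (v : 'I_N -> k) :
  (forall c, c != 0 -> p.@[fun t => c * v t] = 0) <->
  (forall i, (pihomog mdeg i p).@[v] = 0).
Proof.
have evalE c : p.@[fun t => c * v t] =
    \sum_(i < msize p) c ^+ i * (pihomog mdeg i p).@[v].
  rewrite {1}(pihomog_partitionE (leqnn (msize p))) raddf_sum /=.
  by apply: eq_bigr => i _; rewrite (meval_homog _ _ (pihomogP _ _ _)).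
split=> [hp i|hp c _]; last by rewrite evalE big1 // => i _; rewrite hp mulr0.
have P0 : \poly_(i < msize p) (pihomog mdeg i p).@[v] = 0.
  apply: poly_eq0_units => c /hp; rewrite evalE horner_poly => pc.
  by rewrite -[RHS]pc; apply: eq_bigr => j _; rewrite mulrC.
have := congr1 (fun P : {poly k} => P`_i) P0; rewrite coef_poly coef0.
case: ltnP => // le_pi _.
rewrite [pihomog _ _ _]big1_seq ?meval0 // => m /andP[/eqP mi /msize_mdeg_lt].
by rewrite mi ltnNge le_pi.
Qed.

Lemma coordinatesZ c g t : coordinates (c *: g) t = c * coordinates g t.
Proof. by rewrite /coordinates [mpoly_of_dhomog _]hformZ mcoeffZ. Qed.

(** The polynomials in [Q] may be inhomogeneous: since the condition ranges over
    all representatives of [x], which are closed under scaling, it amounts to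
    the vanishing of their homogeneous components. *)
Lemma zariski_closed_zeros (Q : {mpoly k[a]} -> Prop) :
  zariski_closed (fun x => forall g, represents x g ->
                    forall p, Q p -> p.@[coordinates g] = 0).
Proof.
exists (fun q => exists p i, Q p /\ q = pihomog mdeg i p); split.
  by move=> q [p [i [_ ->]]]; exists i; apply: pihomogP.
move=> x; split=> [hx q [p [i [Qp ->]]] g xg|hx g xg p Qp].
  move: i; apply/homog_components_vanish => c c0.
  rewrite -(hx _ (representsZ c0 xg) p Qp).
  by apply: meval_eq => t; rewrite coordinatesZ.
have /homog_components_vanish/(_ 1) :
    forall i, (pihomog mdeg i p).@[coordinates g] = 0.
  by move=> i; apply: hx => //; exists p, i.
rewrite oner_neq0 => <- //; apply: meval_eq => t; by rewrite mul1r.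
Qed.

Lemma zariski_open_nonzeros (Q : {mpoly k[a]} -> Prop) :
  zariski_open (fun x => exists g, represents x g /\
                  exists p, Q p /\ p.@[coordinates g] != 0).
Proof.
have [F [Fh hF]] := zariski_closed_zeros Q; exists F; split=> // x; rewrite -hF.
split=> [hx g xg p Qp|hx [g [xg [p [Qp]]]]]; last by rewrite hx ?eqxx.
apply/eqP; apply: contraT => pg; case: hx; exists g; split=> //.
by exists p.
Qed.

Lemma zariski_openT : zariski_open (fun _ : PN => True).
Proof.
exists (fun p => p = 1); split.
  by move=> p ->; exists 0%N; apply: dhomog1.
move=> x; split=> [[]//|h _]; have [g xg] := represents_exists x.
by have /eqP := h 1 erefl g xg; rewrite meval1 oner_eq0.
Qed.

Lemma rmorph_meval (R R' : comRingType) (phi : {rmorphism R -> R'}) (N : nat)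
    (p : {mpoly R[N]}) h :
  phi p.@[h] = (map_mpoly phi p).@[fun t => phi (h t)].
Proof.
elim/mpolyind: p => [|c m p _ _ IH]; first by rewrite !raddf0.
rewrite !rmorphD /= IH; congr (_ + _).
rewrite map_mpolyZ !mevalZ rmorphM map_mpolyX !mevalX rmorph_prod /=.
by congr (_ * _); apply: eq_bigr => t _; rewrite rmorphXn.
Qed.

Lemma meval_map (N b : nat) (p : {mpoly {mpoly k[b]}[N]}) h (v : 'I_b -> k) :
  (p.@[h]).@[v] = (map_mpoly (meval v) p).@[fun t => (h t).@[v]].
Proof. exact: (rmorph_meval (meval v)). Qed.

(** The locus is stratified by the rank [r] of [C]. Rank at most [r] is the
    vanishing of all larger minors. Given this, a point belongs to [A] iff for
    some nonzero [r]-minor and some vector [w] a polynomial [P j] is nonzero at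
    the image of [w] under [kernel_proj], because these images fill the kernel;
    for fixed [w], [j] and minor this is one polynomial inequality in the
    point. *)
Lemma kernel_nonvanishing_constructible (N M : nat)
    (C : 'M[{mpoly k[a]}]_(N, M)) (J : Type)
    (P : J -> {mpoly {mpoly k[a]}[N]}) (A : PN -> Prop) :
  (forall c (v : 'I_a -> k),
     map_mx (meval (fun t => c * v t)) C = c *: map_mx (meval v) C) ->
  (forall x g, represents x g ->
     A x <-> exists (u : 'rV[k]_N) (j : J),
       u *m map_mx (meval (coordinates g)) C = 0 /\
       (map_mpoly (meval (coordinates g)) (P j)).@[u 0] != 0) ->
  locally_constructible A.
Proof.
move=> C_lin hA x0; exists (fun=> True); split=> //; first exact: zariski_openT.
pose Cv g := map_mx (meval (coordinates g)) C.
pose minors r p := exists q (f : 'I_q -> 'I_N) (g : 'I_q -> 'I_M),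
  (r < q)%N /\ p = \det (mxsub f g C).
(* [value] evaluates [P j] at the image of [w]; [tests] multiplies it by the
   minor, so that it is nonzero only when the minor is. *)
pose value r f (g : 'I_r -> 'I_M) (w : 'rV[k]_N) j : {mpoly k[a]} :=
  (P j).@[(map_mx (@mpolyC a k) w *m kernel_proj C f g) 0].
pose tests r p := exists (f : 'I_r -> 'I_N) (g : 'I_r -> 'I_M) w j,
  p = \det (mxsub f g C) * value r f g w j.
exists N.+1, (fun r x => exists h, represents x h /\
                 exists p, tests r p /\ p.@[coordinates h] != 0),
       (fun r x => forall h, represents x h ->
                 forall p, minors r p -> p.@[coordinates h] = 0).
split=> [r|x _].
  by split; [apply: zariski_open_nonzeros | apply: zariski_closed_zeros].
have minorE q (f : 'I_q -> 'I_N) (g : 'I_q -> 'I_M) h :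
    (\det (mxsub f g C)).@[coordinates h] = \det (mxsub f g (Cv h)).
  by rewrite -det_map_mx map_mxsub.
have valueE r f (g : 'I_r -> 'I_M) w j h :
    (value r f g w j).@[coordinates h] =
    (map_mpoly (meval (coordinates h)) (P j)).@[
      (w *m kernel_proj (Cv h) f g) 0].
  rewrite /value meval_map; apply: meval_eq => t.
  rewrite -map_kernel_proj !mxE raddf_sum; apply: eq_bigr => l _ /=.
  by rewrite mevalM !mxE mevalC.
split=> [Ax|[r [[h [xh [p [[f [g [w [j ->]]]] ph]]]] hr]]].
  have [h xh] := represents_exists x.
  have [u [j [uC Pu]]] := (hA x h xh).1 Ax.
  have le_rN : (\rank (Cv h) < N.+1)%N by rewrite ltnS rank_leq_row.
  exists (Ordinal le_rN); split=> /=; last first.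
    move=> h' xh' p [q [f [g [lt_rq ->]]]]; rewrite minorE; apply/eqP.
    apply: contraTT lt_rq => /minor_rank; rewrite -leqNgt => le_q.
    have [c c0 hE] := represents_scale xh xh'.
    apply: leq_trans le_q _; rewrite hE /Cv.
    rewrite (_ : map_mx _ C = c *: Cv h) ?mxrank_scale_nz //.
    rewrite -C_lin; apply/matrixP => i l; rewrite !mxE.
    by apply: meval_eq => t; rewrite coordinatesZ.
  have [f [g minor0]] := rank_minor (Cv h).
  pose w := (\det (mxsub f g (Cv h)))^-1 *: u.
  exists h; split=> //; exists (\det (mxsub f g C) * value _ f g w j).
  split; first by exists f, g, w, j.
  rewrite mevalM minorE valueE mulf_neq0 //.
  rewrite kernel_proj_id; last by rewrite -scalemxAl uC scaler0.
  by rewrite scalerA divff // scale1r.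
move: ph; rewrite mevalM mulf_eq0 negb_or minorE valueE => /andP[minor0 Pw].
apply/(hA x h xh); exists (w *m kernel_proj (Cv h) f g), j; split=> //.
rewrite -mulmxA -/(Cv h) kernel_proj_kernel ?mulmx0 //.
rewrite leqNgt; apply/negP => lt_r; have [f' [g' /negP[]]] := rank_minor (Cv h).
rewrite -minorE; apply/eqP; apply: hr xh _ _.
by exists (\rank (Cv h)), f', g'.
Qed.

End Zariski.

(** * Forms with indeterminate coefficients *)
Section GenericForms.
Variables (k : closedFieldType) (n : nat).

Lemma monomialP e (m : 'X_{1..n.+1}) :
  mdeg m = e -> exists t : 'I_#|monomial n e|, val (val (enum_val t)) = m.
Proof.
move=> me; have lt_m : (mdeg m < e.+1)%N by rewrite me.
have me' : mdeg (BMultinom lt_m) == e by rewrite /= me.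
exists (enum_rank (exist _ (BMultinom lt_m) me' : monomial n e)).
by rewrite enum_rankK.
Qed.

Lemma monomial_deg e (t : 'I_#|monomial n e|) :
  mdeg (val (val (enum_val t))) = e.
Proof. exact/eqP/(valP (enum_val t)). Qed.

Lemma monomial_inj e (t t' : 'I_#|monomial n e|) :
  val (val (enum_val t)) = val (val (enum_val t')) -> t = t'.
Proof. by move=> /val_inj/val_inj/enum_val_inj. Qed.

Definition form_of (R : comRingType) e (v : 'I_#|monomial n e| -> R) :
    {mpoly R[n.+1]} :=
  \sum_t v t *: 'X_[val (val (enum_val t))].

Lemma map_form_of (R R' : comRingType) (phi : {rmorphism R -> R'}) e
    (v : 'I_#|monomial n e| -> R) :
  map_mpoly phi (form_of v) = form_of (fun t => phi (v t)).
Proof.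
by rewrite raddf_sum; apply: eq_bigr => t _ /=; rewrite map_mpolyZ map_mpolyX.
Qed.

Lemma form_of_coordinates e (g : hform k n e) :
  form_of (coordinates g) = mpoly_of_dhomog g.
Proof.
apply/mpolyP => m; rewrite raddf_sum /=.
case: (eqVneq (mdeg m) e) => [/monomialP[t <-]|ne].
  rewrite (bigD1 t) //= mcoeffZ mcoeffX eqxx mulr1 big1 ?addr0 // => t' ne.
  rewrite mcoeffZ mcoeffX.
  case: eqP => [/monomial_inj e'|_]; last by rewrite mulr0.
  by rewrite e' eqxx in ne.
rewrite (dhomog_nemf_coeff (dhomog_is_dhomog g)) // big1 // => t _.
rewrite mcoeffZ mcoeffX; case: eqP => [mE|_]; last by rewrite mulr0.
by rewrite -mE monomial_deg eqxx in ne.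
Qed.

Variable d : 'I_n.+1 -> nat.
Local Notation N := #|coef_index d|.

(** The index [t] stands for the coefficient at [mono t] of the form number
    [slot t]. *)
Definition slot (t : 'I_N) : 'I_n.+1 := tag (enum_val t).
Definition mono (t : 'I_N) : 'X_{1..n.+1} := val (val (tagged (enum_val t))).

Lemma mono_deg t : mdeg (mono t) = d (slot t).
Proof. exact/eqP/(valP (tagged (enum_val t))). Qed.

Lemma slot_mono_inj t t' : slot t = slot t' -> mono t = mono t' -> t = t'.
Proof.
rewrite /slot /mono => e1 e2; apply: enum_val_inj.
case: (enum_val t) (enum_val t') e1 e2 => [i x] [i' x'] /= e1.
by case: i' / e1 x' => x' /val_inj/val_inj->.
Qed.

Lemma slot_monoP i (m : 'X_{1..n.+1}) :
  mdeg m = d i -> exists t, slot t = i /\ mono t = m.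
Proof.
move=> me; have lt_m : (mdeg m < (d i).+1)%N by rewrite me.
have me' : mdeg (BMultinom lt_m) == d i by rewrite /= me.
pose u : monomial n (d i) := exist _ (BMultinom lt_m) me'.
by exists (enum_rank (Tagged (fun i => monomial n (d i)) u : coef_index d));
  rewrite /slot /mono enum_rankK.
Qed.

Definition tuple_form (R : comRingType) (u : 'I_N -> R) (i : 'I_n.+1) :
    {mpoly R[n.+1]} :=
  \sum_(t | slot t == i) u t *: 'X_[mono t].

Lemma map_tuple_form (R R' : comRingType) (phi : {rmorphism R -> R'})
    (u : 'I_N -> R) i :
  map_mpoly phi (tuple_form u i) = tuple_form (fun t => phi (u t)) i.
Proof.
by rewrite raddf_sum; apply: eq_bigr => t _ /=; rewrite map_mpolyZ map_mpolyX.
Qed.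

Lemma tuple_form_homog (R : comRingType) (u : 'I_N -> R) i :
  tuple_form u i \is (d i).-homog.
Proof.
apply: rpred_sum => t /eqP <-; apply: rpredZ.
by rewrite dhomogX /= mono_deg.
Qed.

Lemma mcoeff_tuple_form (R : comRingType) (u : 'I_N -> R) t :
  (tuple_form u (slot t))@_(mono t) = u t.
Proof.
rewrite raddf_sum (bigD1 t) //= mcoeffZ mcoeffX eqxx mulr1 big1 ?addr0 //.
move=> t' /andP[/eqP e ne]; rewrite mcoeffZ mcoeffX.
case: eqP => [/(slot_mono_inj e) e'|_]; last by rewrite mulr0.
by rewrite e' eqxx in ne.
Qed.

Lemma tuple_form_coefficients (f : forall i, hform k n (d i)) i :
  tuple_form (coefficients f) i = mpoly_of_dhomog (f i).
Proof.
apply/mpolyP => m.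
case: (eqVneq (mdeg m) (d i)) => [/slot_monoP[t [<- <-]]|ne].
  by rewrite mcoeff_tuple_form.
rewrite !(dhomog_nemf_coeff _ ne) //; first exact: dhomog_is_dhomog.
exact: tuple_form_homog.
Qed.

Definition hform_tuple (u : 'I_N -> k) i : hform k n (d i) :=
  DHomog (tuple_form_homog u i).

Lemma coefficients_hform_tuple u t : coefficients (hform_tuple u) t = u t.
Proof. exact: mcoeff_tuple_form. Qed.

(** The determinant of [jacobian] over an arbitrary coefficient ring, which
    allows the coefficients to be indeterminates. *)
Definition det_jac (R : comRingType) (f : 'I_n.+1 -> {mpoly R[n.+1]}) :
    {mpoly R[n.+1]} :=
  \det (\matrix_(i, j) mderiv j (f i)).

Lemma map_mderiv (R R' : comRingType) (phi : {rmorphism R -> R'}) j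
    (p : {mpoly R[n.+1]}) :
  map_mpoly phi (mderiv j p) = mderiv j (map_mpoly phi p).
Proof.
apply/mpolyP => m.
by rewrite mcoeff_map_mpoly !mcoeff_mderiv mcoeff_map_mpoly /= rmorphMn.
Qed.

Lemma map_det_jac (R R' : comRingType) (phi : {rmorphism R -> R'}) f :
  map_mpoly phi (det_jac f) = det_jac (fun i => map_mpoly phi (f i)).
Proof.
rewrite /det_jac -det_map_mx; congr (\det _); apply/matrixP => i j.
by rewrite !mxE /= map_mderiv.
Qed.

Lemma map_apolar_coef (R R' : comRingType) (phi : {rmorphism R -> R'}) K
    (m : 'X_{1..n.+1}) f g :
  phi (apolar_coef K m f g) =
  apolar_coef K m (map_mpoly phi f) (map_mpoly phi g).
Proof.
rewrite rmorph_sum; apply: eq_bigr => m' _ /=.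
by rewrite !rmorphM /= rmorph_nat !mcoeff_map_mpoly.
Qed.

Lemma msize_map_le (R R' : comRingType) (phi : {rmorphism R -> R'})
    (p : {mpoly R[n.+1]}) :
  (msize (map_mpoly phi p) <= msize p)%N.
Proof.
rewrite [X in (X <= _)%N]msizeE; apply/bigmax_leqP_seq => m + _.
rewrite mcoeff_msupp mcoeff_map_mpoly => pm; apply: msize_mdeg_lt.
by rewrite mcoeff_msupp; apply: contraNneq pm => ->; rewrite raddf0.
Qed.

Section Universal.
Variables (s : nat) (R : comRingType) (v : 'I_#|monomial n s| -> R).

(** [form_of v] has degree [s], so its derivatives have no monomial of degree
    above [s]. *)
Definition catalecticant_cols : finType := ('I_n.+1 * 'X_{1..n.+1 < s.+1})%type.

(** For each [i], the block of rows with [slot t = i] and columns with first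
    component [i] is the classical catalecticant matrix of [form_of v] in degree
    [d i]. *)
Definition catalecticant : 'M[R]_(N, #|catalecticant_cols|) :=
  \matrix_(t, c) if slot t == (enum_val c).1 then
    (mderivm (mono t) (form_of v))@_(val (enum_val c).2) else 0.

(** The bound [msize J] remains valid for every specialisation of the
    indeterminate coefficients, as specialising only shrinks the support. *)
Definition jac_contraction (m : 'X_{1..n.+1}) : {mpoly R[N]} :=
  let J := det_jac (tuple_form (fun t => 'X_t : {mpoly R[N]})) in
  apolar_coef (msize J) m J (form_of (fun t => (v t)%:MP)).

Variable phi : {rmorphism R -> k}.

Lemma jac_contractionE m (u : 'I_N -> k) :
  (map_mpoly phi (jac_contraction m)).@[u] =
  (apolar (\det (jacobian (tuple_form u))) (form_of (fun t => phi (v t))))@_m.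
Proof.
pose psi : {rmorphism {mpoly R[N]} -> k} := meval u \o map_mpoly phi.
rewrite -[LHS]/(psi (jac_contraction m)) /jac_contraction.
set J := det_jac _; rewrite map_apolar_coef map_form_of.
have eJ : map_mpoly psi J = \det (jacobian (tuple_form u)).
  rewrite map_det_jac; congr (\det _); apply/matrixP => i j; rewrite !mxE.
  rewrite map_tuple_form; congr mderiv; apply: eq_bigr => t _; congr (_ *: _).
  by rewrite /psi /= map_mpolyX mevalXU.
rewrite (mcoeff_apolar _ _ (K := msize J)) -?eJ ?msize_map_le //.
rewrite /apolar_coef; apply: eq_bigr => m' _; congr (_ * _ * _).
congr (_@__); apply: eq_bigr => t _; congr (_ *: _).
by rewrite /psi /= map_mpolyC mevalC.
Qed.

Lemma catalecticant_kernel (u : 'rV[k]_N) :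
  (u *m map_mx phi catalecticant = 0) <->
  (forall i, apolar (tuple_form (u 0) i) (form_of (fun t => phi (v t))) = 0).
Proof.
set g := form_of _.
have entry i m : (apolar (tuple_form (u 0) i) g)@_m =
    \sum_(t | slot t == i) u 0 t * (mderivm (mono t) g)@_m.
  rewrite /tuple_form (big_morph (fun p => apolar p g) (id1 := 0) (op1 := +%R)).
  - rewrite raddf_sum; apply: eq_bigr => t _.
    by rewrite apolarZl apolarX /= mcoeffZ.
  - by move=> p q; rewrite apolarDl.
  - exact: apolar0l.
have mulE c : (u *m map_mx phi catalecticant) 0 c =
    (apolar (tuple_form (u 0) (enum_val c).1) g)@_(val (enum_val c).2).
  rewrite mxE entry [RHS]big_mkcond; apply: eq_bigr => t _; rewrite !mxE.
  case: eqP => _; last by rewrite rmorph0 mulr0.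
  congr (_ * _); rewrite !mcoeff_mderivm rmorphMn /=.
  by rewrite -mcoeff_map_mpoly map_form_of.
split=> [uC i|hu]; last by apply/rowP => c; rewrite mulE hu mcoeff0 mxE.
apply/mpolyP => m; rewrite mcoeff0.
case: (ltnP (mdeg m) s.+1) => [lt_m|gt_m].
  have := mulE (enum_rank ((i, BMultinom lt_m) : catalecticant_cols)).
  by rewrite uC mxE enum_rankK => <-.
rewrite entry big1 // => t _.
rewrite mcoeff_mderivm /g raddf_sum big1 ?mul0rn ?mulr0 //.
move=> t' _ /=; rewrite mcoeffZ mcoeffX.
case: eqP => [e|_]; last by rewrite mulr0.
have es : mdeg (mono t + m)%MM = s by rewrite -e; apply: monomial_deg.
by move: gt_m; rewrite -es mdegD ltnNge leq_addl.
Qed.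

End Universal.
End GenericForms.

(** * Constructibility of the criterion *)
Section Constructible.
Variables (k : closedFieldType) (n : nat) (d : 'I_n.+1 -> nat).
Variable Res : {mpoly k[#|coef_index d|]}.
Local Notation N := #|coef_index d|.
Local Notation s := (socle_degree d).
Local Notation a := #|monomial n s|.

Lemma generating_tupleP (H : {mpoly k[n.+1]}) :
  (exists f, generating_tuple Res f H) <->
  exists u : 'rV[k]_N,
    [/\ Res.@[u 0] != 0, forall i, apolar (tuple_form (u 0) i) H = 0
      & apolar (\det (jacobian (tuple_form (u 0)))) H != 0].
Proof.
split=> [[f [Rf fH JH]]|[u [Ru uH JH]]].
  exists (\row_t coefficients f t).
  have uE : (\row_t coefficients f t) 0 =1 coefficients f.
    by move=> t; rewrite mxE.
  have fE i :
      tuple_form ((\row_t coefficients f t) 0) i = mpoly_of_dhomog (f i).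
    rewrite -tuple_form_coefficients; apply: eq_bigr => t _; by rewrite uE.
  rewrite (meval_eq _ uE) (eq_jacobian fE); split=> // i.
  by rewrite fE.
exists (hform_tuple (u 0)); split=> //.
by rewrite (meval_eq _ (coefficients_hform_tuple (u 0))).
Qed.

Lemma generating_tuple_constructible (A : projective (hform k n s) -> Prop) :
  (forall x g, represents x g ->
     A x <-> exists f, generating_tuple Res f (mpoly_of_dhomog g)) ->
  locally_constructible A.
Proof.
move=> hA; pose X t : {mpoly k[a]} := 'X_t.
pose P m : {mpoly {mpoly k[a]}[N]} :=
  map_mpoly (@mpolyC a k) Res * jac_contraction d X m.
have evX (v : 'I_a -> k) t : meval v (X t) = v t by rewrite mevalXU.
have formX v : form_of (fun t => meval v (X t)) = form_of v.
  by apply: eq_bigr => t _; rewrite evX.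
apply: (kernel_nonvanishing_constructible (C := catalecticant d X) (P := P)).
  move=> c v; apply/matrixP => t j; rewrite !mxE.
  case: eqP => _; last by rewrite !rmorph0 mulr0.
  rewrite !mcoeff_mderivm !rmorphMn -!mcoeff_map_mpoly !map_form_of !formX.
  rewrite mulrnAr; congr (_ *+ _); rewrite -mcoeffZ; congr (_@__).
  rewrite scaler_sumr; apply: eq_bigr => l _; by rewrite scalerA.
move=> x g xg; rewrite (hA x g xg) generating_tupleP.
have PE u m : (map_mpoly (meval (coordinates g)) (P m)).@[u] =
    Res.@[u] * (apolar (\det (jacobian (tuple_form u))) (mpoly_of_dhomog g))@_m.
  rewrite /P rmorphM mevalM jac_contractionE formX form_of_coordinates.
  congr (_.@[_] * _); apply/mpolyP => m'.
  by rewrite !mcoeff_map_mpoly /= mevalC.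
have kerE u := catalecticant_kernel X (meval (coordinates g)) u.
split=> [[u [Ru uH JH]]|[u [m [uC]]]].
  pose q := apolar (\det (jacobian (tuple_form (u 0)))) (mpoly_of_dhomog g).
  exists u, (mlead q).
  split; first by apply/kerE => i; rewrite formX form_of_coordinates.
  by rewrite PE mulf_neq0 // mleadc_eq0.
rewrite PE mulf_eq0 negb_or => /andP[Ru Jm]; exists u; split=> // [i|].
  by have /kerE/(_ i) := uC; rewrite formX form_of_coordinates.
by apply: contraNneq Jm => ->; rewrite mcoeff0.
Qed.

End Constructible.

Theorem proposition2p4 (k : closedFieldType) (kchar0 : [pchar k] =i pred0)
    (n : nat) (d : 'I_n.+1 -> nat)
    (d_ge2 : forall i, (2 <= d i)%N)
    (d_sorted : forall i j : 'I_n.+1, (i <= j)%N -> (d i <= d j)%N)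
    (Res : {mpoly k[#|coef_index d|]}) (HRes : is_resultant Res) :
  (forall (H : hform k n (socle_degree d)) (H0 : H != 0),
     complete_intersection d (annihilator (mpoly_of_dhomog H)) <->
     ~ included (fiber (Z1 Res) (point H0)) (fiber (@Z2 k n d) (point H0)))
  /\ locally_constructible
       (fun h : projective (hform k n (socle_degree d)) =>
          ~ included (fiber (Z1 Res) h) (fiber (@Z2 k n d) h)).
Proof.
have d_gt0 i : (0 < d i)%N by apply: leq_trans (d_ge2 i).
split=> [H H0|].
  rewrite (fiber_not_included Res (represents_point H0)).
  exact: complete_intersection_iff.
by apply: generating_tuple_constructible => x g; apply: fiber_not_included.
Qed.
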